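(* Let $k$ be an infinite perfect field and let $X=\mathbb P_1$ be the projective line over $k$. Then $$\prod_{x\in X}N_x=(\Sigma_X^* )^{\perp\!\!\!\perp}/\Sigma_X^*,$$ where $\prod_{x\in X} N_x\subset\bar{\mathbb I}_X^1$ is regarded as a subgroup of the quotient $\bar{\mathbb I}_X^1/\Sigma_X^*$ via the projection map; and hence $(\Sigma_X^* )^{\perp\!\!\!\perp}/\Sigma_X^*=0$ if and only if $k$ is algebraically closed.
   Context: Notation: $x\in X$ always denotes a closed point of $X$. $\Sigma_X$ is the function field; $v_x$ is the normalized discrete valuation at $x$; $\widehat{\mathcal O}_{X,x}$ is the completion of the local ring at $x$, with maximal ideal $\widehat{\mathfrak m}_x$, fraction field $K_x$ and residue field $k(x)$; $\deg(x)=[k(x):k]$; $\widehat{\mathcal O}_{X,x}^*\simeq k(x)^*\times(1+\widehat{\mathfrak m}_x)$. The adele ring is $\mathbb A_X=\prod'_{x}K_x$ (restricted product with respect to the $\widehat{\mathcal O}_{X,x}$), the idele group is $\mathbb I_X=\mathbb A_X^*$, $\mathbb I_X^1=\{\alpha\in\mathbb I_X : \sum_x\deg(x)v_x(\alpha_x)=0\}$, and $\bar{\mathbb I}_X^1=\mathbb I_X^1/\prod_{x}(1+\widehat{\mathfrak m}_x)$. Global pairing $\langle\cdot,\cdot\rangle:\mathbb I_X\times\mathbb I_X\to k^*$: $$\langle\alpha,\beta\rangle=\prod_{x}(-1)^{\deg(x)v_x(\alpha_x)v_x(\beta_x)}N_{k(x)/k}\Big(\frac{\alpha_x^{v_x(\beta_x)}}{\beta_x^{v_x(\alpha_x)}}(x)\Big),$$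 where $(x)$ denotes the residue class in $k(x)$. It is trivial on $\Sigma_X^*\times\Sigma_X^*$ (Weil reciprocity, $\Sigma_X^*$ embedded diagonally) and induces a pairing on $\bar{\mathbb I}_X^1$. $\Sigma_X^*$ is regarded as a subgroup of $\bar{\mathbb I}_X^1$ because $\Sigma_X^*\cap\prod_x(1+\widehat{\mathfrak m}_x)=\{1\}$. For $G\subseteq\bar{\mathbb I}_X^1$, $G^{\perp\!\!\!\perp}=\{\alpha\in\bar{\mathbb I}_X^1:\langle\alpha,g\rangle=1\ \forall g\in G\}$. $N_x=\{\lambda\in k(x):N_{k(x)/k}(\lambda)=1\}$, and $\prod_xN_x\subseteq\prod_xk(x)^*\subset\bar{\mathbb I}_X^1$. *)

(* Defs.v *)
From HB Require Import structures.
From mathcomp Require Import all_boot all_order all_algebra all_field.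
From mathcomp Require Import all_classical.
From mathcomp Require Import ring lra zify.

Set Implicit Arguments.
Unset Strict Implicit.
Unset Printing Implicit Defensive.

Import Order.TTheory GRing.Theory Num.Theory.
Local Open Scope ring_scope.
Local Open Scope quotient_scope.

(* The value at 0, conventionally +oo, is irrelevant in a [valuation]. *)
Record valuation (R : idomainType) := Valuation {
  vfun :> R -> int;
  valuationM : forall a b, a != 0 -> b != 0 -> vfun (a * b) = vfun a + vfun b;
  valuationD : forall a b, a != 0 -> b != 0 -> a + b != 0 ->
    Num.min (vfun a) (vfun b) <= vfun (a + b) }.

(* v a >= n, with the convention v 0 = +oo *)
Definition val_ge (R : idomainType) (v : valuation R) (n : int) (a : R) : bool :=
  (a == 0) || (n <= v a).

Notation "x %:F" := (@FracField.tofrac _ x) : ring_scope.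

Local Ltac vlia :=
  repeat match goal with H : context [vfun _ _] |- _ => move: H end;
  repeat match goal with |- context [vfun ?v ?x] => move: (vfun v x) => ? end;
  lia.

Section ValuationTheory.
Variables (R : idomainType) (v : valuation R).

Lemma valuation1 : v 1 = 0.
Proof.
have := valuationM v (oner_neq0 R) (oner_neq0 R); rewrite mulr1; vlia.
Qed.

Lemma valuationN a : v (- a) = v a.
Proof.
have [->|a0] := eqVneq a 0; first by rewrite oppr0.
have n1 : (-1 : R) != 0 by rewrite oppr_eq0 oner_neq0.
have := valuationM v n1 n1; rewrite mulrNN mulr1 valuation1 => h.
by rewrite -mulN1r valuationM //; vlia.
Qed.

Lemma val_geD n a b : val_ge v n a -> val_ge v n b -> val_ge v n (a + b).
Proof.
rewrite /val_ge; have [->|a0] := eqVneq a 0; first by rewrite add0r.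
have [->|b0] := eqVneq b 0; first by rewrite addr0 (negbTE a0).
have [//|ab0 /= na nb] := eqVneq (a + b) 0.
by apply: le_trans (valuationD v a0 b0 ab0); rewrite le_min na.
Qed.

Lemma val_geN n a : val_ge v n (- a) = val_ge v n a.
Proof. by rewrite /val_ge oppr_eq0 valuationN. Qed.

Lemma val_geB n a b : val_ge v n a -> val_ge v n b -> val_ge v n (a - b).
Proof. by move=> na nb; rewrite val_geD ?val_geN. Qed.

Lemma val_geM m n a b :
  val_ge v m a -> val_ge v n b -> val_ge v (m + n) (a * b).
Proof.
rewrite /val_ge mulf_eq0; have [->//|a0] := eqVneq a 0.
by have [->//|b0 /=] := eqVneq b 0; rewrite valuationM //; vlia.
Qed.

Lemma val_geW m n a : m <= n -> val_ge v n a -> val_ge v m a.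
Proof. by rewrite /val_ge => mn /orP[->//|/(le_trans mn)->]; rewrite orbT. Qed.

Lemma val_ge0 n : val_ge v n 0. Proof. by rewrite /val_ge eqxx. Qed.

Lemma val_ge1 : val_ge v 0 1. Proof. by rewrite /val_ge valuation1 orbT. Qed.

Lemma val_geE n a : a != 0 -> val_ge v n a = (n <= v a).
Proof. by rewrite /val_ge => /negbTE ->. Qed.

Lemma valuation_near a b : a != 0 -> val_ge v (v a + 1) (b - a) ->
  b != 0 /\ v b = v a.
Proof.
move=> a0 h; have b0 : b != 0.
  apply: contraTneq h => ->.
  by rewrite sub0r val_geN val_geE // -ltNge; vlia.
split=> //.
have h1 : val_ge v (v a) b.
  rewrite -(subrK a b) val_geD //; last by rewrite val_geE.
  by apply: val_geW h; vlia.
rewrite val_geE // in h1; apply/eqP; rewrite eq_le h1 andbT.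
rewrite leNgt; apply/negP => h2.
have : val_ge v (v a + 1) (b - (b - a)).
  by rewrite val_geB // val_geE //; vlia.
by rewrite subKr val_geE //; vlia.
Qed.

End ValuationTheory.

Lemma valuationV (F : fieldType) (v : valuation F) (a : F) :
  a != 0 -> v a^-1 = - v a.
Proof.
move=> a0; have := valuationM v a0 (invr_neq0 a0).
by rewrite mulfV // valuation1; vlia.
Qed.

Section OneUnits.
Variables (F : fieldType) (v : valuation F).
Implicit Types a b u w : F.

Lemma valuation_unit a b : a * b = 1 -> val_ge v 0 a -> val_ge v 0 b -> v a = 0.
Proof.
move=> ab ha hb.
have a0 : a != 0 by apply: contra_eq_neq ab => ->; rewrite mul0r eq_sym oner_neq0.
have b0 : b != 0 by apply: contra_eq_neq ab => ->; rewrite mulr0 eq_sym oner_neq0.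
have := valuationM v a0 b0; rewrite ab valuation1.
by move: ha hb; rewrite !val_geE //; vlia.
Qed.

Lemma valuationXz a (n : int) : a != 0 -> v (a ^ n) = n * v a.
Proof.
move=> a0; have vX m : v (a ^+ m) = m%:Z * v a.
  elim: m => [|m IH]; first by rewrite expr0 valuation1 mul0r.
  by rewrite exprS valuationM ?expf_neq0 // IH intS mulrDl mul1r.
case: n => m; first exact: vX.
by rewrite NegzE -[a ^ _]/((a ^+ m.+1)^-1) valuationV ?expf_neq0 // vX mulNr.
Qed.

(* The group 1 + m, where m is the maximal ideal defined by v >= 1 *)
Definition one_unit a : bool := val_ge v 1 (a - 1).

Lemma one_unit1 : one_unit 1.
Proof. by rewrite /one_unit subrr val_ge0. Qed.

Lemma one_unit_val a : one_unit a -> a != 0 /\ v a = 0.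
Proof.
move=> ha; rewrite -(valuation1 v); apply: valuation_near.
  exact: oner_neq0.
by rewrite valuation1 add0r.
Qed.

Lemma one_unitV a : one_unit a -> one_unit a^-1.
Proof.
move=> ha; have [a0 va] := one_unit_val ha; rewrite /one_unit.
have -> : a^-1 - 1 = - (a^-1 * (a - 1)) by rewrite mulrBr mulVf // mulr1 opprB.
rewrite val_geN -[1%R : int]add0r val_geM //.
by rewrite val_geE ?invr_neq0 // valuationV // va.
Qed.

Lemma one_unitM a b : one_unit a -> one_unit b -> one_unit (a * b).
Proof.
move=> ha hb; have [a0 va] := one_unit_val ha; rewrite /one_unit.
have -> : a * b - 1 = a * (b - 1) + (a - 1) by rewrite mulrBr mulr1 addrA subrK.
apply: val_geD => //; rewrite -[1%R : int]add0r val_geM //.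
by rewrite val_geE // va.
Qed.

Lemma one_unitX a (n : int) : one_unit a -> one_unit (a ^ n).
Proof.
move=> ha; have hX m : one_unit (a ^+ m).
  by elim: m => [|m IH]; [exact: one_unit1 | rewrite exprS one_unitM].
by case: n => m; [exact: hX | exact: one_unitV].
Qed.

Lemma one_unit_valM a u : a != 0 -> one_unit u -> v (a * u) = v a.
Proof.
by move=> a0 /one_unit_val[u0 vu]; rewrite valuationM // vu addr0.
Qed.

Lemma one_unit_congr a u b : val_ge v 0 a -> one_unit u ->
  val_ge v 1 (a * u - b) = val_ge v 1 (a - b).
Proof.
move=> ha hu; have h : val_ge v 1 (a * u - a).
  have -> : a * u - a = a * (u - 1) by rewrite mulrBr mulr1.
  by rewrite -[1%R : int]add0r val_geM.
apply/idP/idP => hf.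
  have -> : a - b = (a * u - b) - (a * u - a) by ring.
  exact: val_geB.
have -> : a * u - b = (a * u - a) + (a - b) by ring.
exact: val_geD.
Qed.

Lemma symbol_one_unit a b u w (m n : int) :
  (a * u) ^ n / (b * w) ^ m = (a ^ n / b ^ m) * (u ^ n / w ^ m).
Proof. by rewrite !expfzMl invfM mulrACA. Qed.

Lemma symbol_ge0 a b : a != 0 -> b != 0 -> val_ge v 0 (a ^ v b / b ^ v a).
Proof.
move=> a0 b0; rewrite val_geE ?mulf_neq0 ?invr_neq0 ?expfz_neq0 //.
rewrite valuationM ?invr_neq0 ?expfz_neq0 // valuationV ?expfz_neq0 //.
by rewrite !valuationXz // mulrC subrr.
Qed.

Lemma symbol_congr (K : unitRingType) (d : nat) (R : F -> K) a b u w :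
  (forall c t, val_ge v 0 c -> one_unit t -> R (c * t) = R c) ->
  a != 0 -> b != 0 -> one_unit u -> one_unit w ->
  (-1) ^ (d%:Z * v (a * u) * v (b * w)) *
    R ((a * u) ^ v (b * w) / (b * w) ^ v (a * u)) =
  (-1) ^ (d%:Z * v a * v b) * R (a ^ v b / b ^ v a).
Proof.
move=> hR a0 b0 hu hw; rewrite !one_unit_valM //.
rewrite symbol_one_unit hR ?symbol_ge0 //.
by apply: one_unitM; [|apply: one_unitV]; exact: one_unitX.
Qed.

End OneUnits.

Section FractionValuation.
Variables (R : idomainType) (v : valuation R).

Definition frac_vfun (a : {fraction R}) : int := v \n_(repr a) - v \d_(repr a).

Lemma fracP (a : {fraction R}) :
  exists x y, [/\ y != 0, a = x%:F / y%:F & frac_vfun a = v x - v y].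
Proof.
exists \n_(repr a), \d_(repr a); have d0 := denom_ratioP (repr a); split=> //.
apply: (canRL (mulfK _)); first by rewrite tofrac_eq0.
rewrite -{1}[a]reprK; move: (repr a) d0 => r d0.
unlock FracField.tofrac; rewrite -[LHS]FracField.pi_mul.
apply/eqP; rewrite eqmodE /= /FracField.equivf.
rewrite /FracField.mulf !numden_Ratio ?mulr1 ?mulf_neq0 ?oner_neq0 //.
by rewrite mulrC.
Qed.

Lemma frac_vfunE x y : x != 0 -> y != 0 -> frac_vfun (x%:F / y%:F) = v x - v y.
Proof.
move=> x0 y0; have [x' [y' [y'0 e ->]]] := fracP (x%:F / y%:F).
have F0 (z : R) : z != 0 -> z%:F != 0 by move=> ?; rewrite tofrac_eq0.
have x'0 : x' != 0.
  apply: contra_neq (mulf_neq0 (F0 _ x0) (invr_neq0 (F0 _ y0))) => x'0.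
  by rewrite e x'0 tofrac0 mul0r.
move/eqP: e; rewrite eqr_div ?F0 // -!tofracM tofrac_eq => /eqP e.
by have := congr1 v e; rewrite !valuationM //; vlia.
Qed.

Fact frac_vfunM a b : a != 0 -> b != 0 ->
  frac_vfun (a * b) = frac_vfun a + frac_vfun b.
Proof.
have [x [y [y0 -> ->]]] := fracP a; have [z [t [t0 -> ->]]] := fracP b.
rewrite !mulf_eq0 !invr_eq0 !tofrac_eq0 !negb_or => /andP[x0 _] /andP[z0 _].
rewrite mulf_div -!tofracM frac_vfunE ?mulf_neq0 // !valuationM //; vlia.
Qed.

Fact frac_vfunD a b : a != 0 -> b != 0 -> a + b != 0 ->
  Num.min (frac_vfun a) (frac_vfun b) <= frac_vfun (a + b).
Proof.
have [x [y [y0 -> ->]]] := fracP a; have [z [t [t0 -> ->]]] := fracP b.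
rewrite addf_div ?tofrac_eq0 // -!tofracM -tofracD.
rewrite !mulf_eq0 !invr_eq0 !tofrac_eq0 !negb_or.
move=> /andP[x0 _] /andP[z0 _] /andP[s0 _].
rewrite frac_vfunE ?mulf_neq0 //.
have := valuationD v (mulf_neq0 x0 t0) (mulf_neq0 z0 y0) s0.
rewrite !valuationM //; vlia.
Qed.

Definition frac_valuation := Valuation frac_vfunM frac_vfunD.

End FractionValuation.

Section Completion.
Variables (F : fieldType) (v : valuation F).

Record local_ring := LocalElt { local_val : F; _ : val_ge v 0 local_val }.

HB.instance Definition _ := [isSub for local_val].
HB.instance Definition _ := [Choice of local_ring by <:].

Fact val_ge0_subring : subring_closed (val_ge v 0 : {pred F}).
Proof.
split=> [|a b|a b]; rewrite -?topredE /=.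
- exact: val_ge1.
- exact: val_geB.
- by move=> ha hb; rewrite -[0]addr0 val_geM.
Qed.

HB.instance Definition _ :=
  GRing.SubChoice_isSubComNzRing.Build F (val_ge v 0) local_ring val_ge0_subring.

(* The n-th power of the maximal ideal of [local_ring] is given by v >= n. *)
Definition cauchy (s : nat -> local_ring) : bool :=
  `[< forall n : nat, exists N, forall i j, (N <= i)%N -> (N <= j)%N ->
      val_ge v n (local_val (s i) - local_val (s j)) >].

Definition null (s : nat -> local_ring) : bool :=
  `[< forall n : nat, exists N, forall i, (N <= i)%N ->
      val_ge v n (local_val (s i)) >].

Record cauchy_seq := CauchySeq { seq_val : nat -> local_ring; _ : cauchy seq_val }.

HB.instance Definition _ := [isSub for seq_val].
HB.instance Definition _ := [Choice of cauchy_seq by <:].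

Lemma local_ge0 (a : local_ring) : val_ge v 0 (local_val a).
Proof. by case: a. Qed.

Lemma local_valB (a b : local_ring) : local_val (a - b) = local_val a - local_val b.
Proof. exact: (rmorphB (val : local_ring -> F)). Qed.

Lemma local_valM (a b : local_ring) : local_val (a * b) = local_val a * local_val b.
Proof. exact: (rmorphM (val : local_ring -> F)). Qed.

Fact cauchy_subring : subring_closed (cauchy : {pred nat -> local_ring}).
Proof.
split=> [|s t|s t]; rewrite -?topredE /=.
- by apply/asboolP => n; exists 0 => i j _ _; rewrite subrr val_ge0.
- move=> /asboolP hs /asboolP ht; apply/asboolP => n.
  have [N hN] := hs n; have [M hM] := ht n; exists (maxn N M) => i j.
  rewrite !geq_max => /andP[Ni Mi] /andP[Nj Mj].
  rewrite !local_valB.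
  have -> : local_val (s i) - local_val (t i) - (local_val (s j) - local_val (t j))
     = (local_val (s i) - local_val (s j)) - (local_val (t i) - local_val (t j)).
    by ring.
  by rewrite val_geB ?hN ?hM.
- move=> /asboolP hs /asboolP ht; apply/asboolP => n.
  have [N hN] := hs n; have [M hM] := ht n; exists (maxn N M) => i j.
  rewrite !geq_max => /andP[Ni Mi] /andP[Nj Mj].
  rewrite !local_valM.
  have -> : local_val (s i) * local_val (t i) - local_val (s j) * local_val (t j)
     = local_val (s i) * (local_val (t i) - local_val (t j))
       + (local_val (s i) - local_val (s j)) * local_val (t j).
    by ring.
  apply: val_geD; first by rewrite -[n%:Z]add0r val_geM ?local_ge0 ?hM.
  by rewrite -[n%:Z]addr0 val_geM ?local_ge0 ?hN.
Qed.

HB.instance Definition _ :=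
  GRing.SubChoice_isSubComNzRing.Build _ cauchy cauchy_seq cauchy_subring.

Definition null_seq (s : cauchy_seq) : bool := null (seq_val s).

(* A Cauchy sequence which is not null has an eventually constant value. *)
Lemma cauchy_val (s : cauchy_seq) : ~~ null_seq s ->
  exists n N, forall i, (N <= i)%N ->
    local_val (seq_val s i) != 0 /\ v (local_val (seq_val s i)) = n.
Proof.
case: s => s /= /[dup] /asboolP hs hs' /asboolPn /existsNP[n hn].
have [N hN] := hs n.
have [i [Ni hi]] : exists i, (N <= i)%N /\ ~~ val_ge v n (local_val (s i)).
  apply: contrapT => h; apply: hn; exists N => i Ni.
  by apply: contrapT => /negP hi; apply: h; exists i.
move: hi; rewrite /val_ge negb_or -ltNge => /andP[i0 lt_n].
exists (v (local_val (s i))), N => j Nj.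
apply: valuation_near => //; apply: val_geW (hN j i Nj Ni); vlia.
Qed.

Fact null_seq_idealr : idealr_closed (null_seq : {pred cauchy_seq}).
Proof.
split; rewrite -?topredE /=.
- by apply/asboolP => n; exists 0 => i _; exact: val_ge0.
- apply/negP => /asboolP /(_ 1)[N /(_ N (leqnn N))].
  by rewrite val_geE ?oner_neq0 // valuation1.
- move=> a s t; rewrite -!topredE /= => /asboolP hs /asboolP ht.
  apply/asboolP => n; have [N hN] := hs n; have [M hM] := ht n.
  exists (maxn N M) => i; rewrite !geq_max => /andP[Ni Mi].
  have -> : local_val (seq_val (a * s + t) i) =
    local_val (seq_val a i) * local_val (seq_val s i) + local_val (seq_val t i).
    by [].
  apply: val_geD; last exact: hM.
  by rewrite -[n%:Z]add0r val_geM ?local_ge0 ?hN.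
Qed.

HB.instance Definition _ := isIdealr.Build cauchy_seq null_seq null_seq_idealr.

Fact null_seq_prime : prime_idealr_closed null_seq.
Proof.
move=> s t; rewrite -!topredE /= => /asboolP hst; apply: contrapT => /negP.
rewrite negb_or => /andP[/cauchy_val[m [M hM]] /cauchy_val[n [N hN]]].
have [L hL] := hst (absz (m + n + 1)).
pose i := maxn L (maxn M N).
have := hL i (leq_maxl _ _).
have Mi : (M <= i)%N by rewrite /i; lia.
have Ni : (N <= i)%N by rewrite /i; lia.
have [s0 vs] := hM i Mi; have [t0 vt] := hN i Ni.
have -> : local_val (seq_val (s * t) i) = local_val (seq_val s i) * local_val (seq_val t i).
  by [].
rewrite val_geE ?mulf_neq0 // valuationM // vs vt; lia.
Qed.

HB.instance Definition _ := isPrimeIdealrClosed.Build cauchy_seq null_seq null_seq_prime.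

Definition completion := Quotient.quot (null_seq : prime_idealr cauchy_seq).

HB.instance Definition _ := GRing.ComNzRing.on completion.
HB.instance Definition _ := EqQuotient.on completion.

Definition completion_unit (a : completion) : bool := `[< exists b, b * a = 1 >].

Definition completion_inv (a : completion) : completion :=
  if completion_unit a then xget 0 [set b | b * a = 1]%classic else a.

Fact completion_mulVr : {in completion_unit, left_inverse 1 completion_inv *%R}.
Proof.
move=> a; rewrite -topredE /= => ua; rewrite /completion_inv ua.
by move/asboolP: ua => [b ba]; apply: (@xgetPex _ 0 [set b | b * a = 1]%classic); exists b.
Qed.

Fact completion_unitPl (a b : completion) : b * a = 1 -> completion_unit a.
Proof. by move=> ba; apply/asboolP; exists b. Qed.

Fact completion_invr_out : {in [predC completion_unit], completion_inv =1 id}.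
Proof. by move=> a; rewrite inE /completion_inv -topredE /= => /negbTE ->. Qed.

HB.instance Definition _ := GRing.ComNzRing_hasMulInverse.Build completion
  completion_mulVr completion_unitPl completion_invr_out.

Fact completion_idomain : GRing.integral_domain_axiom completion.
Proof. exact: Quotient.rquot_IdomainAxiom. Qed.

HB.instance Definition _ := GRing.ComUnitRing_isIntegral.Build completion
  completion_idomain.

Lemma seq_valM (s t : cauchy_seq) i : local_val (seq_val (s * t) i) =
  local_val (seq_val s i) * local_val (seq_val t i).
Proof. by []. Qed.

Lemma seq_valD (s t : cauchy_seq) i : local_val (seq_val (s + t) i) =
  local_val (seq_val s i) + local_val (seq_val t i).
Proof. by []. Qed.

Lemma pi_completion (a : completion) : exists s : cauchy_seq, a = \pi_completion s.
Proof. by exists (repr a); rewrite reprK. Qed.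

Lemma pi_completion_eq (s t : cauchy_seq) :
  (\pi_completion s == \pi_completion t) = null_seq (s - t).
Proof. by rewrite [LHS]eqmodE. Qed.

Lemma pi_completion_eq0 (s : cauchy_seq) : (\pi_completion s == 0) = null_seq s.
Proof.
by rewrite -[0 in LHS](rmorph0 (\pi_completion)) pi_completion_eq subr0.
Qed.

(* The valuations of the terms of a non-null Cauchy sequence are eventually
   constant, and so do not depend on the representative. *)
Definition completion_vfun (a : completion) : int :=
  xget 0 [set n | exists N, forall i, (N <= i)%N ->
    v (local_val (seq_val (repr a) i)) = n]%classic.

Lemma completion_vfunE (s : cauchy_seq) n N : ~~ null_seq s ->
  (forall i, (N <= i)%N -> v (local_val (seq_val s i)) = n) ->
  completion_vfun (\pi_completion s) = n.
Proof.
move=> s0 vs; have [m [M hM]] := cauchy_val s0.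
have mn : m = n.
  have [_ <-] := hM (maxn M N) (leq_maxl _ _).
  by rewrite vs ?leq_maxr.
have : null_seq (repr (\pi_completion s) - s).
  by rewrite -pi_completion_eq reprK.
move=> /asboolP /(_ (absz (n + 1)))[L hL].
have vr i : (maxn L (maxn M N) <= i)%N ->
    v (local_val (seq_val (repr (\pi_completion s)) i)) = n.
  rewrite !geq_max => /and3P[Li Mi Ni].
  have [si0 vsi] := hM i Mi.
  have := @valuation_near _ v _ (local_val (seq_val (repr (\pi_completion s)) i)) si0.
  case=> [|_ ->]; last by rewrite vsi.
  apply: val_geW (hL i Li); rewrite vsi mn; lia.
rewrite /completion_vfun.
case: xgetP => [p -> [P hP]|/(_ n)[]]; last by exists (maxn L (maxn M N)).
rewrite -(hP (maxn P (maxn L (maxn M N))) (leq_maxl _ _)).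
by rewrite vr ?leq_maxr.
Qed.

Fact completion_vfunM a b : a != 0 -> b != 0 ->
  completion_vfun (a * b) = completion_vfun a + completion_vfun b.
Proof.
have [s ->] := pi_completion a; have [t ->] := pi_completion b => a0 b0.
have := mulf_neq0 a0 b0; rewrite -rmorphM !pi_completion_eq0 in a0 b0 * => ab0.
have [m [M hM]] := cauchy_val a0; have [n [N hN]] := cauchy_val b0.
have -> := @completion_vfunE s m M a0 (fun i Mi => (hM i Mi).2).
have -> := @completion_vfunE t n N b0 (fun i Mi => (hN i Mi).2).
apply: (@completion_vfunE _ _ (maxn M N)) => // i; rewrite geq_max => /andP[Mi Ni].
have [s0 <-] := hM i Mi; have [t0 <-] := hN i Ni.
by rewrite seq_valM (valuationM v s0 t0).
Qed.

Fact completion_vfunD a b : a != 0 -> b != 0 -> a + b != 0 ->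
  Num.min (completion_vfun a) (completion_vfun b) <= completion_vfun (a + b).
Proof.
have [s ->] := pi_completion a; have [t ->] := pi_completion b => a0 b0.
rewrite -rmorphD !pi_completion_eq0 in a0 b0 * => ab0.
have [m [M hM]] := cauchy_val a0; have [n [N hN]] := cauchy_val b0.
have [p [P hP]] := cauchy_val ab0.
have -> := @completion_vfunE s m M a0 (fun i Mi => (hM i Mi).2).
have -> := @completion_vfunE t n N b0 (fun i Mi => (hN i Mi).2).
have -> := @completion_vfunE _ p P ab0 (fun i Mi => (hP i Mi).2).
pose i := maxn P (maxn M N).
have [Mi Ni Pi] : [/\ (M <= i)%N, (N <= i)%N & (P <= i)%N].
  by split; rewrite /i !leq_max leqnn ?orbT.
have [s0 <-] := hM i Mi; have [t0 <-] := hN i Ni; have [+ <-] := hP i Pi.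
rewrite seq_valD => st0; exact: (valuationD v s0 t0 st0).
Qed.

Definition completion_valuation := Valuation completion_vfunM completion_vfunD.

Lemma completion_val_ge0 a : val_ge completion_valuation 0 a.
Proof.
have [->|a0] := eqVneq a 0; first exact: val_ge0.
rewrite val_geE //=; have [s e] := pi_completion a; rewrite {a}e in a0 *.
rewrite pi_completion_eq0 in a0; have [m [M hM]] := cauchy_val a0.
rewrite (@completion_vfunE s m M a0 (fun i Mi => (hM i Mi).2)).
have [s0 <-] := hM M (leqnn M).
by rewrite -val_geE // local_ge0.
Qed.

Fact cauchy_cst (a : local_ring) : cauchy (fun=> a).
Proof. by apply/asboolP => n; exists 0 => i j _ _; rewrite subrr val_ge0. Qed.

Definition to_completion (a : local_ring) : completion :=
  \pi_completion (CauchySeq (cauchy_cst a)).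

Lemma to_completionM (a b : local_ring) :
  to_completion (a * b) = to_completion a * to_completion b.
Proof.
by rewrite /to_completion -rmorphM; congr (\pi_completion _); apply: val_inj.
Qed.

Lemma to_completion_eq0 (a : local_ring) : (to_completion a == 0) = (a == 0).
Proof.
rewrite pi_completion_eq0; apply/asboolP/eqP => [h|-> n]; last first.
  by exists 0 => i _; exact: val_ge0.
apply: val_inj => /=; apply/eqP; apply: contrapT => /negP a0.
have [N /(_ N (leqnn N)) /=] := h (absz (v (local_val a) + 1)).
by rewrite val_geE // => ?; vlia.
Qed.

End Completion.

Notation completed_field v := {fraction completion v}.
Notation completed_valuation v := (frac_valuation (completion_valuation v)).

Section Embedding.
Variables (F : fieldType) (v : valuation F).

(* For f in F, either f or f^-1 lies in the local ring. *)
Definition to_completed_field (f : F) : completed_field v :=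
  if val_ge v 0 f then (to_completion (insubd (0 : local_ring v) f))%:F
  else ((to_completion (insubd (0 : local_ring v) f^-1))%:F)^-1.

Lemma local_insubd f : val_ge v 0 f ->
  local_val (insubd (0 : local_ring v) f) = f.
Proof. by move=> hf; apply: (@insubdK _ _ (local_ring v)). Qed.

Lemma local_inj : injective (@local_val F v).
Proof. exact: val_inj. Qed.

Lemma to_completed_fieldE (a b : local_ring v) : b != 0 ->
  to_completed_field (local_val a / local_val b) =
  (to_completion a)%:F / (to_completion b)%:F.
Proof.
move=> b0; have vb0 : local_val b != 0 by [].
set f := _ / _; rewrite /to_completed_field; case: ifPn => hf.
  apply: (canRL (mulfK _)); first by rewrite tofrac_eq0 to_completion_eq0.
  rewrite -tofracM -to_completionM; congr (to_completion _)%:F.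
  by apply: local_inj; rewrite local_valM local_insubd // /f divfK.
have f0 : f != 0 by apply: contraNneq hf => ->; exact: val_ge0.
have hf' : val_ge v 0 f^-1.
  rewrite val_geE // -ltNge in hf.
  by rewrite val_geE ?invr_neq0 // valuationV // oppr_ge0 ltW.
have a0 : a != 0.
  apply: contra_neq f0 => a0; rewrite /f a0.
  by have -> : local_val (0 : local_ring v) = 0 by []; rewrite mul0r.
rewrite -[RHS]invrK [X in _ = X^-1]invf_div; congr (_^-1).
apply: (canRL (mulfK _)); first by rewrite tofrac_eq0 to_completion_eq0.
rewrite -tofracM -to_completionM; congr (to_completion _)%:F.
by apply: local_inj; rewrite local_valM local_insubd // /f invf_div divfK.
Qed.

Lemma local_frac (f : F) :
  exists a b : local_ring v, b != 0 /\ f = local_val a / local_val b.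
Proof.
have [hf|hf] := boolP (val_ge v 0 f).
  exists (LocalElt hf), 1; rewrite oner_neq0.
  by have -> : local_val (1 : local_ring v) = 1 by []; rewrite divr1.
have f0 : f != 0 by apply: contraNneq hf => ->; exact: val_ge0.
have hf' : val_ge v 0 f^-1.
  rewrite val_geE // -ltNge in hf.
  by rewrite val_geE ?invr_neq0 // valuationV // oppr_ge0 ltW.
exists 1, (LocalElt hf'); split; first by rewrite -val_eqE /= invr_neq0.
by have -> : local_val (1 : local_ring v) = 1 by []; rewrite /= invrK mul1r.
Qed.

Lemma to_completed_fieldM f g :
  to_completed_field (f * g) = to_completed_field f * to_completed_field g.
Proof.
have [a [b [b0 ->]]] := local_frac f; have [c [d [d0 ->]]] := local_frac g.
rewrite mulf_div -!local_valM !to_completed_fieldE ?mulf_neq0 //.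
by rewrite !to_completionM !tofracM mulf_div.
Qed.

Lemma to_completed_field1 : to_completed_field 1 = 1.
Proof.
have := @to_completed_fieldE 1 1 (oner_neq0 _).
have -> : local_val (1 : local_ring v) = 1 by [].
by rewrite divr1 => ->; rewrite divff // tofrac_eq0 to_completion_eq0 oner_neq0.
Qed.

Lemma to_completed_fieldV f : f != 0 ->
  to_completed_field f^-1 = (to_completed_field f)^-1.
Proof.
move=> f0; have e := to_completed_fieldM f f^-1.
rewrite divff // to_completed_field1 in e.
have g0 : to_completed_field f != 0.
  by apply: contra_eq_neq e => ->; rewrite mul0r oner_neq0.
by apply: (mulfI g0); rewrite -e divff.
Qed.

End Embedding.

Section PolyOrder.
Variables (k : fieldType) (p : {poly k}).

(* The multiplicity of p in a nonzero polynomial a. *)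
Definition poly_order (a : {poly k}) : nat := \max_(i < size a | p ^+ i %| a) i.

Hypothesis pI : irreducible_poly p.

Lemma poly_orderP a : a != 0 ->
  exists b, a = b * p ^+ poly_order a /\ ~~ (p %| b).
Proof.
move=> a0; have p0 := irredp_neq0 pI; have sa : (0 < size a)%N by rewrite size_poly_gt0.
have div_lt n : p ^+ n %| a -> (n < size a)%N.
  move=> /(dvdp_leq a0); apply: leq_trans.
  rewrite -(prednK (_ : 0 < size (p ^+ n))%N) ?size_poly_gt0 ?expf_neq0 //.
  rewrite size_exp ltnS leq_pmull //.
  by case: pI => + _; case: (size p) => [|[]].
have [|i pi e] := @eq_bigmax_cond _ [pred i : 'I_(size a) | p ^+ i %| a] (fun i => i : nat).
  by apply/card_gt0P; exists (Ordinal sa); rewrite inE /= expr0 dvd1p.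
have ord_i : poly_order a = i by [].
rewrite ord_i; move: pi; rewrite inE => pi; exists (a %/ p ^+ i).
rewrite divpK //; split=> //; apply/negP => pb.
have pi1 : p ^+ i.+1 %| a
  by have := dvdp_mul pb (dvdpp (p ^+ i)); rewrite divpK // -exprS.
have := @leq_bigmax_cond _ [pred i : 'I_(size a) | p ^+ i %| a] (fun i => i : nat)
  (Ordinal (div_lt _ pi1)) pi1.
by rewrite [X in (_ <= X)%N]ord_i /= ltnn.
Qed.

Lemma poly_orderE b n : ~~ (p %| b) -> poly_order (b * p ^+ n) = n.
Proof.
have p0 := irredp_neq0 pI; move=> pb.
have b0 : b != 0 by apply: contraNneq pb => ->; rewrite dvdp0.
have [c []] := poly_orderP (mulf_neq0 b0 (expf_neq0 n p0)).
set m := poly_order _ => e pc; case: (ltngtP m n) => // mn; exfalso.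
- move: e; rewrite -(subnK (ltnW mn)) exprD mulrA => /(mulIf (expf_neq0 _ p0)) e.
  by move: pc; rewrite -e dvdp_mull // -(prednK (_ : 0 < n - m)%N) ?subn_gt0 // exprS dvdp_mulr.
- move: e; rewrite -(subnK (ltnW mn)) exprD mulrA => /(mulIf (expf_neq0 _ p0)) e.
  by move: pb; rewrite e dvdp_mull // -(prednK (_ : 0 < m - n)%N) ?subn_gt0 // exprS dvdp_mulr.
Qed.

Lemma irredp_dvdM a b : (p %| a * b) = (p %| a) || (p %| b).
Proof.
apply/idP/orP => [pab|[]]; [|exact: dvdp_mulr|exact: dvdp_mull].
have [|pa] := boolP (p %| a); [by left|right].
by rewrite -(@Gauss_dvdpr _ b a p) // irreducible_poly_coprime.
Qed.

Fact poly_orderM a b : a != 0 -> b != 0 ->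
  (poly_order (a * b))%:Z = (poly_order a)%:Z + (poly_order b)%:Z.
Proof.
move=> a0 b0; have [c [ea pc]] := poly_orderP a0; have [d [eb pd]] := poly_orderP b0.
rewrite {1}ea {1}eb mulrACA -exprD poly_orderE ?PoszD //.
by rewrite irredp_dvdM negb_or pc.
Qed.

Fact poly_orderD a b : a != 0 -> b != 0 -> a + b != 0 ->
  Num.min (poly_order a)%:Z (poly_order b)%:Z <= (poly_order (a + b))%:Z.
Proof.
move=> a0 b0 ab0; have [c [ea pc]] := poly_orderP a0.
have [d [eb pd]] := poly_orderP b0; have [e [es pe]] := poly_orderP ab0.
have pM m n u : (m <= n)%N -> p ^+ m %| u * p ^+ n.
  by move=> mn; rewrite dvdp_mull // dvdp_exp2l.
suff : (minn (poly_order a) (poly_order b) <= poly_order (a + b))%N by lia.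
rewrite leqNgt; apply: contra pe => lt_min.
have : p ^+ (poly_order (a + b)).+1 %| a + b.
  by rewrite {2}ea {2}eb dvdp_add // pM //; apply: leq_trans lt_min _;
    rewrite (geq_minl, geq_minr).
by rewrite {2}es exprS dvdp_mul2r // expf_neq0 // irredp_neq0.
Qed.

Definition order_valuation := Valuation poly_orderM poly_orderD.

End PolyOrder.

Section ClosedPoints.
Variable k : fieldType.

Fact opp_degM (a b : {poly k}) : a != 0 -> b != 0 ->
  - (size (a * b)).-1%:Z = - (size a).-1%:Z - (size b).-1%:Z.
Proof.
move=> a0 b0; rewrite size_mul //.
by move: a0 b0; rewrite -!size_poly_gt0; move: (size a) (size b) => m n; lia.
Qed.

Fact opp_degD (a b : {poly k}) : a != 0 -> b != 0 -> a + b != 0 ->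
  Num.min (- (size a).-1%:Z) (- (size b).-1%:Z) <= - (size (a + b)).-1%:Z.
Proof. 
move=> _ _ _; have := size_polyD a b.
by move: (size a) (size b) (size _) => l m n; lia.
 Qed.

Definition opp_deg_valuation := Valuation opp_degM opp_degD.

(* A closed point of the affine line is a maximal ideal of k[t], given by its monic
   generator. *)
Inductive closed_point :=
  | AffinePoint (p : {poly k}) of monic_irreducible_poly p
  | PointAtInfinity.

HB.instance Definition _ := gen_eqMixin closed_point.
HB.instance Definition _ := gen_choiceMixin closed_point.

Definition function_field : fieldType := {fraction {poly k}}.

(* The restriction to k[t] of the normalized valuation at x. *)
Definition poly_valuation (x : closed_point) : valuation {poly k} :=
  match x with
  | AffinePoint p pI => order_valuation pI.1
  | PointAtInfinity => opp_deg_valuation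
  end.

Definition point_valuation (x : closed_point) : valuation function_field :=
  frac_valuation (poly_valuation x).

Definition residue_field (x : closed_point) : fieldExtType k :=
  match x with
  | AffinePoint p pI => {poly %/ p with pI}
  | PointAtInfinity => k^o
  end.

Definition point_degree (x : closed_point) : nat := \dim {: residue_field x}.

(* The value f(x) in k(x) of a function f without pole at x. At an affine point,
   f = a / b must first be put in lowest terms; at infinity, f(x) is the quotient
   of the coefficients of degree deg b. *)
Definition value_at (x : closed_point) (f : function_field) : residue_field x :=
  let a := \n_(repr f) in let b := \d_(repr f) in
  match x return residue_field x with
  | AffinePoint p pI =>
      let g := gcdp a b in
      (in_qpoly p (a %/ g) : {poly %/ p with pI}) / in_qpoly p (b %/ g)
  | PointAtInfinity => (a`_(size b).-1 / lead_coef b : k^o)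
  end.

Definition local_field (x : closed_point) : fieldType :=
  completed_field (point_valuation x).

Definition local_valuation (x : closed_point) : valuation (local_field x) :=
  completed_valuation (point_valuation x).

Definition diagonal (x : closed_point) (f : function_field) : local_field x :=
  to_completed_field (point_valuation x) f.

Definition local_integer (x : closed_point) (a : local_field x) : Prop :=
  exists b : completion (point_valuation x), a = b%:F.

(* The residue class in k(x) of an element a of the completed local ring: the value
   at x of any function f in Sigma_X congruent to a modulo the maximal ideal. *)
Definition residue (x : closed_point) (a : local_field x) : residue_field x :=
  value_at x (xget 0 [set f : function_field |
    val_ge (local_valuation x) 1 (a - diagonal x f)]%classic).

Lemma local_integer_ge0 x (a : local_field x) :
  local_integer a -> val_ge (local_valuation x) 0 a.
Proof.
move=> [b ->]; have [->|b0] := eqVneq b 0; first by rewrite tofrac0 val_ge0.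
rewrite val_geE ?tofrac_eq0 //= -[b%:F]divr1 -tofrac1.
rewrite frac_vfunE ?oner_neq0 // valuation1 subr0.
by rewrite -val_geE // completion_val_ge0.
Qed.

Lemma local_integerM x (a b : local_field x) :
  local_integer a -> local_integer b -> local_integer (a * b).
Proof. by move=> [c ->] [d ->]; exists (c * d); rewrite tofracM. Qed.

Definition adele (alpha : forall x, local_field x) : Prop :=
  finite_set [set x | ~ local_integer (alpha x)]%classic.

Lemma adeleM alpha beta : adele alpha -> adele beta ->
  adele (fun x => alpha x * beta x).
Proof.
move=> ha hb; apply: sub_finite_set (_ : finite_set (_ `|` _)%classic); last first.
  by rewrite finite_setU; split; [exact: ha | exact: hb].
move=> x /= h; apply: contrapT => /not_orP[/contrapT a /contrapT b].
by apply: h; exact: local_integerM.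
Qed.

Lemma adele1 : adele (fun x => 1).
Proof.
apply: sub_finite_set (finite_set0 _) => x /=; apply.
by exists 1; rewrite tofrac1.
Qed.

Record idele := Idele {
  idele_val :> forall x, local_field x;
  idele_adele : adele idele_val;
  idele_unit : exists2 beta, adele beta & forall x, idele_val x * beta x = 1 }.

HB.instance Definition _ := gen_eqMixin idele.
HB.instance Definition _ := gen_choiceMixin idele.

Lemma idele_inj (alpha beta : idele) : (forall x, alpha x = beta x) -> alpha = beta.
Proof.
case: alpha beta => [a ha ua] [b hb ub] /= ab.
have {}ab : a = b by exact: functional_extensionality_dep.
by subst b; congr Idele; exact: Prop_irrelevance.
Qed.

Lemma idele_neq0 (alpha : idele) x : alpha x != 0.
Proof.
have [beta _ /(_ x) e] := idele_unit alpha.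
by apply: contra_eq_neq e => ->; rewrite mul0r eq_sym oner_neq0.
Qed.

Program Definition idele_one : idele := @Idele (fun=> 1) adele1 _.
Next Obligation. by exists (fun=> 1) => [|x]; [exact: adele1 | rewrite mulr1]. Qed.

Program Definition idele_mul (alpha beta : idele) : idele :=
  @Idele (fun x => alpha x * beta x) (adeleM (idele_adele alpha) (idele_adele beta)) _.
Next Obligation.
move=> alpha beta; have [a ha ea] := idele_unit alpha.
have [b hb eb] := idele_unit beta; exists (fun x => a x * b x); first exact: adeleM.
by move=> x; rewrite mulrACA ea eb mulr1.
Qed.

Program Definition idele_inv (alpha : idele) : idele :=
  @Idele (fun x => (alpha x)^-1) _ _.
Next Obligation.
move=> alpha; have [beta + e] := idele_unit alpha; congr adele.
by apply: functional_extensionality_dep => x; apply: (mulfI (idele_neq0 alpha x));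
  rewrite e divff // idele_neq0.
Qed.
Next Obligation.
move=> alpha; exists alpha; first exact: idele_adele.
by move=> x; rewrite mulVf // idele_neq0.
Qed.

Fact idele_mulA : associative idele_mul.
Proof. by move=> a b c; apply: idele_inj => x; rewrite /= mulrA. Qed.
Fact idele_mulC : commutative idele_mul.
Proof. by move=> a b; apply: idele_inj => x; rewrite /= mulrC. Qed.
Fact idele_mul1 : left_id idele_one idele_mul.
Proof. by move=> a; apply: idele_inj => x; rewrite /= mul1r. Qed.
Fact idele_mul1r : right_id idele_one idele_mul.
Proof. by move=> a; rewrite idele_mulC idele_mul1. Qed.
Fact idele_mulV : left_inverse idele_one idele_inv idele_mul.
Proof. by move=> a; apply: idele_inj => x; rewrite /= mulVf // idele_neq0. Qed.
Fact idele_mulVr : right_inverse idele_one idele_inv idele_mul.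
Proof. by move=> a; rewrite idele_mulC idele_mulV. Qed.

HB.instance Definition _ := isGroup.Build idele
  idele_mulA idele_mul1 idele_mul1r idele_mulV idele_mulVr.

End ClosedPoints.

Section QuotientGroup.
Local Open Scope group_scope.
Variables (G : groupType) (H : groupClosed G).

Definition coset_rel (x y : G) : bool := x^-1 * y \in H.

Fact coset_rel_equiv : equiv_class_of coset_rel.
Proof.
rewrite /coset_rel; split=> [x|x y|y x z].
- by rewrite mulVg gpred1.
- by rewrite -gpredV invgM invgK.
- by move=> xy yz; rewrite -(mulgK y x^-1) -mulgA gpredM.
Qed.

Canonical coset_rel_canonical := EquivRelPack coset_rel_equiv.

Definition quotient_group of (forall x y : G, y \in H -> y ^ x \in H) :=
  {eq_quot coset_rel}.

Hypothesis nH : forall x y : G, y \in H -> y ^ x \in H.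
Local Notation Q := (quotient_group nH).

HB.instance Definition _ := EqQuotient.on Q.
HB.instance Definition _ := Choice.on Q.

Lemma quotient_groupE (x y : G) : (\pi_Q x == \pi_Q y) = (x^-1 * y \in H).
Proof. by rewrite [LHS]eqmodE. Qed.

Lemma quotient_group_ind (P : Q -> Prop) : (forall x, P (\pi_Q x)) -> forall a, P a.
Proof. by move=> h a; rewrite -[a]reprK. Qed.

Definition quotient_one : Q := \pi_Q 1.
Definition quotient_mul (a b : Q) : Q := \pi_Q (repr a * repr b).
Definition quotient_inv (a : Q) : Q := \pi_Q (repr a)^-1.

Lemma pi_mul x y : quotient_mul (\pi_Q x) (\pi_Q y) = \pi_Q (x * y).
Proof.
have hx : (repr (\pi_Q x))^-1 * x \in H by rewrite -quotient_groupE reprK.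
have hy : (repr (\pi_Q y))^-1 * y \in H by rewrite -quotient_groupE reprK.
apply/eqP; rewrite quotient_groupE invgM.
set x' := repr _ in hx *; set y' := repr _ in hy *.
have -> : y'^-1 * x'^-1 * (x * y) = (y'^-1 * y) * (x'^-1 * x) ^ y.
  by rewrite /conjg !mulgA mulgK.
by rewrite gpredM // nH.
Qed.

Lemma pi_inv x : quotient_inv (\pi_Q x) = \pi_Q x^-1.
Proof.
have hx : (repr (\pi_Q x))^-1 * x \in H by rewrite -quotient_groupE reprK.
apply/eqP; rewrite quotient_groupE invgK.
set x' := repr _ in hx *.
have -> : x' * x^-1 = ((x'^-1 * x)^-1) ^ x^-1.
  by rewrite /conjg !invgM !invgK mulgA mulVKg.
by rewrite nH // gpredV.
Qed.

Fact quotient_mulA : associative quotient_mul.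
Proof.
elim/quotient_group_ind=> x; elim/quotient_group_ind=> y.
by elim/quotient_group_ind=> z; rewrite !pi_mul mulgA.
Qed.

Fact quotient_mul1g : left_id quotient_one quotient_mul.
Proof. by elim/quotient_group_ind=> x; rewrite pi_mul mul1g. Qed.

Fact quotient_mulg1 : right_id quotient_one quotient_mul.
Proof. by elim/quotient_group_ind=> x; rewrite pi_mul mulg1. Qed.

Fact quotient_mulVg : left_inverse quotient_one quotient_inv quotient_mul.
Proof. by elim/quotient_group_ind=> x; rewrite pi_inv pi_mul mulVg. Qed.

Fact quotient_mulgV : right_inverse quotient_one quotient_inv quotient_mul.
Proof. by elim/quotient_group_ind=> x; rewrite pi_inv pi_mul mulgV. Qed.

HB.instance Definition _ := isGroup.Build Q quotient_mulA quotient_mul1g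
  quotient_mulg1 quotient_mulVg quotient_mulgV.

Lemma quotient_piM x y : \pi_Q (x * y) = \pi_Q x * \pi_Q y.
Proof. by rewrite -pi_mul. Qed.

Lemma quotient_piV x : \pi_Q x^-1 = (\pi_Q x)^-1.
Proof. by rewrite -pi_inv. Qed.

End QuotientGroup.

Lemma fsum_weightD (T : choiceType) (d f g h : T -> int) :
  finite_set [set x | f x <> 0]%classic -> finite_set [set x | g x <> 0]%classic ->
  (forall x, h x = f x + g x) ->
  \sum_(x \in [set: T]) d x * h x =
  \sum_(x \in [set: T]) d x * f x + \sum_(x \in [set: T]) d x * g x.
Proof.
move=> ff fg hE; set S := ([set x | f x <> 0] `|` [set x | g x <> 0])%classic.
have fS : finite_set S by rewrite finite_setU.
have S0 x : ~ S x -> f x = 0 /\ g x = 0.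
  by move=> /not_orP[/contrapT -> /contrapT ->].
rewrite -(fsbig_widen S setT (fun x => d x * h x)) //; last first.
  by move=> x [_ /S0[f0 g0]]; rewrite /= hE f0 g0 mulr0.
rewrite -(fsbig_widen S setT (fun x => d x * f x)) //; last first.
  by move=> x [_ /S0[f0 g0]]; rewrite /= f0 mulr0.
rewrite -(fsbig_widen S setT (fun x => d x * g x)) //; last first.
  by move=> x [_ /S0[f0 g0]]; rewrite /= g0 mulr0.
by rewrite -fsbig_split //; apply: eq_fsbigr => x _; rewrite hE mulrDr.
Qed.

Section ReducedIdeles.
Variable k : fieldType.
Implicit Types (x : closed_point k) (alpha beta : idele k).

Lemma idele_val_finite alpha :
  finite_set [set x | local_valuation x (alpha x) <> 0]%classic.
Proof.
have [beta hb ab] := idele_unit alpha.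
apply: sub_finite_set (_ : finite_set (_ `|` _)%classic); last first.
  by rewrite finite_setU; split; [exact: (idele_adele alpha) | exact: hb].
move=> x /= h; apply: contrapT => /not_orP[/contrapT ha /contrapT hb'].
by apply: h; exact: valuation_unit (ab x) (local_integer_ge0 ha) (local_integer_ge0 hb').
Qed.

Definition idele_degree (alpha : idele k) : int :=
  \sum_(x \in [set: closed_point k]) (point_degree x)%:Z * local_valuation x (alpha x).

Lemma idele_degreeM alpha beta :
  idele_degree (alpha * beta)%g = idele_degree alpha + idele_degree beta.
Proof.
apply: fsum_weightD; [exact: idele_val_finite|exact: idele_val_finite|move=> x].
exact: valuationM (idele_neq0 alpha x) (idele_neq0 beta x).
Qed.

Record idele1 := Idele1 { idele1_val :> idele k; _ : idele_degree idele1_val == 0 }.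

HB.instance Definition _ := [isSub for idele1_val].
HB.instance Definition _ := [Choice of idele1 by <:].

Lemma idele_degree1 : idele_degree 1%g = 0.
Proof. by apply: (addrI (idele_degree 1%g)); rewrite -idele_degreeM mulg1 addr0. Qed.

Fact idele1_group : group_closed (fun alpha => idele_degree alpha == 0).
Proof.
split; rewrite -?topredE /= ?idele_degree1 //.
move=> alpha beta; rewrite -!topredE /= => /eqP da /eqP db.
have := idele_degreeM beta (beta^-1)%g; rewrite mulgV idele_degree1 db add0r => db'.
by rewrite idele_degreeM da -db'.
Qed.

HB.instance Definition _ := SubChoice_isSubGroup.Build (idele k) _ idele1 idele1_group.

Lemma idele1_mulC (a b : idele1) : (a * b = b * a)%g.
Proof. by apply: val_inj; rewrite !valM; exact: idele_mulC. Qed.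

(* The product over x of the groups 1 + m_x *)
Definition one_unit_idele (alpha : idele1) : bool :=
  `[< forall x, one_unit (local_valuation x) (alpha x) >].

Fact one_unit_mul1 : 1%g \in one_unit_idele.
Proof. by apply/asboolP => x; exact: one_unit1. Qed.

Fact one_unit_mulM : mulg_closed one_unit_idele.
Proof.
move=> a b /asboolP ha /asboolP hb; apply/asboolP => x.
by have -> : (a * b)%g x = a x * b x by []; exact: one_unitM.
Qed.

Fact one_unit_mulV : invg_closed one_unit_idele.
Proof.
move=> a /asboolP ha; apply/asboolP => x.
by have -> : (a^-1)%g x = (a x)^-1 by []; exact: one_unitV.
Qed.

HB.instance Definition _ := isMulClosed.Build idele1 one_unit_idele one_unit_mulM.
HB.instance Definition _ := isMul1Closed.Build idele1 one_unit_idele one_unit_mul1.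
HB.instance Definition _ := isInvClosed.Build idele1 one_unit_idele one_unit_mulV.

Fact one_unit_normal : forall a b : idele1, b \in one_unit_idele ->
  (b ^ a)%g \in one_unit_idele.
Proof. by move=> a b; rewrite /conjg idele1_mulC -mulgA mulgV mulg1. Qed.

Definition reduced_idele := quotient_group one_unit_normal.
HB.instance Definition _ := Group.on reduced_idele.
HB.instance Definition _ := EqQuotient.on reduced_idele.

Definition reduced_class (alpha : idele1) : reduced_idele := \pi_reduced_idele alpha.

Lemma reduced_classM a b : reduced_class (a * b)%g = (reduced_class a * reduced_class b)%g.
Proof. exact: quotient_piM. Qed.

Lemma reduced_classV a : reduced_class (a^-1)%g = ((reduced_class a)^-1)%g.
Proof. exact: quotient_piV. Qed.

Lemma reduced_mulC (a b : reduced_idele) : (a * b = b * a)%g.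
Proof.
move: a b.
elim/quotient_group_ind=> a; elim/quotient_group_ind=> b.
by rewrite -!quotient_piM idele1_mulC.
Qed.

Definition is_diagonal (f : function_field k) (alpha : idele k) : Prop :=
  forall x, alpha x = diagonal x f.

(* The image of the multiplicative group of the function field *)
Definition principal (a : reduced_idele) : bool :=
  `[< exists2 f : function_field k, f != 0 &
      exists2 alpha : idele1, is_diagonal f alpha & a = reduced_class alpha >].

Fact principal_mul1 : 1%g \in principal.
Proof.
apply/asboolP; exists 1; first exact: oner_neq0.
by exists 1%g => // x; rewrite /diagonal to_completed_field1.
Qed.

Fact principal_mulM : mulg_closed principal.
Proof.
move=> a b /asboolP[f f0 [alpha ha ->]] /asboolP[g g0 [beta hb ->]].
apply/asboolP.
exists (f * g).
  exact: (mulf_neq0 f0 g0).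
exists (alpha * beta)%g; last by rewrite reduced_classM.
move=> x; have -> : (alpha * beta)%g x = alpha x * beta x by [].
by rewrite ha hb; exact: (esym (to_completed_fieldM _ _ _)).
Qed.

Fact principal_mulV : invg_closed principal.
Proof.
move=> a /asboolP[f f0 [alpha ha ->]].
apply/asboolP.
exists f^-1.
  exact: (invr_neq0 f0).
exists (alpha^-1)%g; last by rewrite reduced_classV.
move=> x; have -> : (alpha^-1)%g x = (alpha x)^-1 by [].
by rewrite ha; exact: (esym (to_completed_fieldV _ f0)).
Qed.

HB.instance Definition _ := isMulClosed.Build reduced_idele principal principal_mulM.
HB.instance Definition _ := isMul1Closed.Build reduced_idele principal principal_mul1.
HB.instance Definition _ := isInvClosed.Build reduced_idele principal principal_mulV.

Fact principal_normal : forall a b : reduced_idele, b \in principal ->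
  (b ^ a)%g \in principal.
Proof. by move=> a b; rewrite /conjg reduced_mulC -mulgA mulgV mulg1. Qed.

Definition reduced_idele_class := quotient_group principal_normal.
HB.instance Definition _ := Group.on reduced_idele_class.
HB.instance Definition _ := EqQuotient.on reduced_idele_class.

Definition class_proj (a : reduced_idele) : reduced_idele_class :=
  \pi_reduced_idele_class a.

End ReducedIdeles.

(* The norm of a finite extension: the determinant of multiplication by a. *)
Definition field_norm (F : fieldType) (L : fieldExtType F) (a : L) : F :=
  \det (passmx.mxof (vbasis {:L}) (vbasis {:L}) (amull a)).

Section Pairing.
Variable k : fieldType.
Implicit Types (x : closed_point k).

Definition local_pairing x (a b : local_field x) : k :=
  let m := local_valuation x a in let n := local_valuation x b in
  (-1) ^ ((point_degree x)%:Z * m * n) * field_norm (residue (a ^ n / b ^ m)).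

Definition idele_pairing (alpha beta : idele k) : k :=
  \big[*%R/1]_(x \in [set: closed_point k]) local_pairing (alpha x) (beta x).

(* This is independent of the representatives, see [reduced_pairingE]. *)
Definition reduced_pairing (a b : reduced_idele k) : k :=
  idele_pairing (repr a : idele1 k) (repr b : idele1 k).

Lemma residue_one_unit x (a u : local_field x) :
  val_ge (local_valuation x) 0 a -> one_unit (local_valuation x) u ->
  residue (a * u) = residue a.
Proof.
move=> ha hu; rewrite /residue; congr (value_at x (xget 0 _)).
by apply/seteqP; split=> f /=; rewrite (one_unit_congr _ ha hu).
Qed.

Lemma local_pairing_one_unit x (a b u w : local_field x) : a != 0 -> b != 0 ->
  one_unit (local_valuation x) u -> one_unit (local_valuation x) w ->
  local_pairing (a * u) (b * w) = local_pairing a b.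
Proof.
move=> a0 b0 hu hw.
apply: (symbol_congr (point_degree x) (R := fun c => field_norm (residue c))) a0 b0 hu hw.
by move=> c t hc ht; exact: (congr1 (@field_norm _ _) (residue_one_unit hc ht)).
Qed.

Lemma reduced_pairingE (alpha beta : idele1 k) :
  reduced_pairing (reduced_class alpha) (reduced_class beta) = idele_pairing alpha beta.
Proof.
have hrepr (a : idele1 k) : exists2 u : idele1 k,
    (forall x, one_unit (local_valuation x) (u x)) &
    forall x, (repr (reduced_class a) : idele1 k) x = a x * u x.
  exists (a^-1 * repr (reduced_class a))%g.
    apply/asboolP; change ((a^-1 * repr (reduced_class a))%g \in @one_unit_idele k).
    by rewrite -(quotient_groupE (@one_unit_normal k)) reprK.
  move=> x; set r : idele1 k := repr _.
  have -> : (a^-1 * r : idele1 k)%g x = (a x)^-1 * r x by [].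
  by rewrite (mulVKf (idele_neq0 a x)).
have [u hu eu] := hrepr alpha; have [w hw ew] := hrepr beta.
apply: eq_fsbigr => x _; rewrite eu ew.
exact: (local_pairing_one_unit (idele_neq0 alpha x) (idele_neq0 beta x) (hu x) (hw x)).
Qed.

Definition perp (G : set (reduced_idele k)) : set (reduced_idele k) :=
  [set a | forall g, G g -> reduced_pairing a g = 1]%classic.

Definition local_unit x (a : local_field x) : Prop :=
  exists2 b : completion (point_valuation x), b \is a GRing.unit & a = b%:F.

Definition norm_one x : set (residue_field x) :=
  [set a | field_norm a = 1]%classic.

(* The subgroup of reduced ideles which corresponds to the product of the [norm_one]
   under the isomorphism, induced by [residue], between the group of units of the
   completed local ring modulo the [one_unit]s and the group k(x)^*. *)
Definition prod_norm_one : set (reduced_idele k) :=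
  [set a | exists2 alpha : idele1 k, a = reduced_class alpha &
    forall x, local_unit (alpha x) /\ norm_one (residue (alpha x))]%classic.

End Pairing.

Arguments norm_one {k} x _.
Arguments prod_norm_one k _ : clear implicits.

(* Equivalently, every algebraic extension of F is separable. *)
Definition perfect_field (F : fieldType) : Prop :=
  forall p : {poly F}, irreducible_poly p -> separable_poly p.

(* Main.v *)
(* For alpha orthogonal to the principal ideles there is, X being the projective line, a
   function f with the same affine valuations as alpha. Weil reciprocity makes f isotropic,
   so u = alpha / f is a unit idele orthogonal to every monic irreducible polynomial p:
   this reads N(u_p) = u_oo ^ deg p = N(u_oo), so that u / u_oo lies in the product of the
   groups N_x. Weil reciprocity itself is checked on pairs of irreducible polynomials, where
   it is the symmetry of the resultant: over a splitting field of p q both norms are, up to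
   sign, the product of the differences of the roots.

   If 1 is the only element of norm 1 in k(x) = k[t]/(p), then a^n = N(a) for all a, with
   n = deg p; taking a = t - c for infinitely many c in k gives p = (X - t)^n, which
   contradicts separability unless n = 1. *)
Require Import Defs.
From HB Require Import structures.
From mathcomp Require Import all_boot all_order all_algebra all_field.
From mathcomp Require Import all_classical.
From mathcomp Require Import ring zify.

Set Implicit Arguments.
Unset Strict Implicit.
Unset Printing Implicit Defensive.

Import Order.TTheory GRing.Theory Num.Theory.
Local Open Scope ring_scope.

(* all_classical shadows this name by the diagonal of a product. *)
Local Notation diagonal := Defs.diagonal.

(** * Norms and resultants *)

(** The two inclusions differ in nature. That of [prod_norm_one] is local: a unit [a] has symbol
    [N(a(x)) ^ v(b)] with any [b]. The converse is global and uses that k[t] is principal: every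
    divisor on the affine line comes from a product of powers of monic irreducible polynomials, and
    degree 0 then settles the valuation at infinity. Since the symbol is multiplicative in its first
    argument, reciprocity of such a product against one irreducible polynomial follows from the case
    of two irreducible polynomials, and the converse tests nothing more. The projection is injective
    on [prod_norm_one] because a function without zeros and poles is a constant, which the residue
    at infinity forces to be 1. As [residue] chooses an approximating function, density of the local
    ring is what makes it multiplicative, with the one-units as kernel. *)

Section MatrixRepresentation.
Variables (k : fieldType) (L : fieldExtType k).

(** The regular representation of [L], whose determinant is by definition [field_norm]. *)
Definition mulmx_of (a : L) : 'M[k]_(\dim {:L}) :=
  passmx.mxof (vbasis {:L}) (vbasis {:L}) (amull a).

Lemma mulmx_of_linear : linear mulmx_of.
Proof. by move=> c a b; rewrite /mulmx_of amull_is_linear passmx.mxof_linear. Qed.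

Lemma mulmx_ofM a b : mulmx_of (a * b) = mulmx_of a *m mulmx_of b.
Proof.
by rewrite mulrC /mulmx_of amullM (passmx.mxof_comp _ _ (vbasisP _)).
Qed.

Lemma mulmx_of1 : mulmx_of 1 = 1%:M.
Proof. by rewrite /mulmx_of amull1 passmx.mxof1 // (basis_free (vbasisP _)). Qed.

Lemma mulmx_of_inj : injective mulmx_of.
Proof. by move=> a b /(can_inj (passmx.mxofK (vbasisP _) (vbasisP _)))/amull_inj. Qed.

Lemma field_norm1 : field_norm (1 : L) = 1.
Proof. by rewrite -[LHS]/(\det (mulmx_of 1)) mulmx_of1 det1. Qed.

Lemma field_normM (a b : L) : field_norm (a * b) = field_norm a * field_norm b.
Proof. by rewrite -[LHS]/(\det (mulmx_of _)) mulmx_ofM det_mulmx. Qed.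

Lemma mulmx_ofZ c : mulmx_of c%:A = c%:M.
Proof.
have := mulmx_of_linear c 1 0; have := mulmx_of_linear (-1) 0 0.
rewrite scaler0 addr0 scaleN1r addNr => -> ; rewrite !addr0 => ->.
by rewrite mulmx_of1 scalemx1.
Qed.

Lemma field_norm_scalar c : field_norm (c%:A : L) = c ^+ \dim {:L}.
Proof. by rewrite -[LHS]/(\det (mulmx_of _)) mulmx_ofZ det_scalar. Qed.

Lemma field_norm_neq0 (a : L) : a != 0 -> field_norm a != 0.
Proof.
move=> a0; have := field_normM a a^-1; rewrite divff // field_norm1 => e.
by apply: contra_eq_neq e => ->; rewrite mul0r oner_neq0.
Qed.

Lemma field_normV (a : L) : a != 0 -> field_norm a^-1 = (field_norm a)^-1.
Proof.
move=> a0; apply: (mulfI (field_norm_neq0 a0)).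
by rewrite -field_normM !divff ?field_norm1 // field_norm_neq0.
Qed.

Lemma field_normX (a : L) n : field_norm (a ^+ n) = field_norm a ^+ n.
Proof.
by elim: n => [|n IH]; rewrite ?expr0 ?field_norm1 // !exprS field_normM IH.
Qed.

Lemma field_norm_dim1 (a : L) : \dim {:L} = 1%N -> field_norm a = 1 -> a = 1.
Proof.
move=> d1; have := memvf a.
have <- : (1%VS = {:L})%VS by apply/eqP; rewrite eqEdim subvf d1 dimv1.
by move=> /vlineP[c ->]; rewrite field_norm_scalar d1 expr1 => ->; rewrite scale1r.
Qed.

Section Horner.
Variable theta : L.
Local Notation "p ^%" := (map_poly (in_alg L) p).

(** An algebra representation commutes with polynomial evaluation. An abstract [M] of successor size
    is used because [horner_mx] needs such a size, and [\dim {:L}] does not have that form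
    syntactically. *)
Lemma repr_horner n (M : L -> 'M[k]_n.+1) (q : {poly k}) :
  linear M -> (forall a b, M (a * b) = M a *m M b) -> M 1 = 1%:M ->
  M (q^%).[theta] = horner_mx (M theta) q.
Proof.
move=> Ml MM M1; have MD a b : M (a + b) = M a + M b.
  by have := Ml 1 a b; rewrite !scale1r.
have M0 : M 0 = 0.
  by apply: (addrI (M 0)); rewrite -MD !addr0.
elim/poly_ind: q => [|q c IH]; first by rewrite !rmorph0 horner0 M0.
rewrite !rmorphD !rmorphM /= map_polyX map_polyC hornerMXaddC MD MM IH.
have := Ml c 1 0; rewrite !addr0 M0 addr0 M1 scalemx1 => ->.
by rewrite horner_mx_C horner_mx_X.
Qed.

(* By Cayley-Hamilton theta is a root of the characteristic polynomial, which has the same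
   degree as p. *)
Lemma repr_char_poly n (M : L -> 'M[k]_n.+1) (p : {poly k}) :
  linear M -> (forall a b, M (a * b) = M a *m M b) -> M 1 = 1%:M -> injective M ->
  monic_irreducible_poly p -> root (p^%) theta -> (size p).-1 = n.+1 ->
  char_poly (M theta) = p.
Proof.
move=> Ml MM M1 Minj [pI pm] rp sp.
set c := char_poly _.
have c0 : c != 0 by apply: monic_neq0; exact: char_poly_monic.
have rc : root (c^%) theta.
  apply/eqP/Minj; rewrite repr_horner // /c Cayley_Hamilton.
  have := Ml (-1) 0 0; rewrite scaler0 addr0 => e.
  by rewrite e scaleN1r addNr.
have pc : p %| c.
  apply: negbNE; rewrite -irreducible_poly_coprime // -(coprimep_map (in_alg L)).
  by apply/negP => /coprimep_root/(_ rp); rewrite (eqP rc) eqxx.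
apply/eqP; rewrite eq_sym -eqp_monic ?char_poly_monic // -dvdp_size_eqp //.
rewrite size_char_poly -sp prednK //.
by case: pI => /ltnW.
Qed.

(** Each linear factor contributes [det (A - b)], which is [(-1) ^ n.+1] times the characteristic
    polynomial at [b]; this accounts for the sign. *)
Lemma det_horner_mx_split (K : fieldType) (f : {rmorphism k -> K}) n
    (A : 'M[k]_n.+1) (q : {poly k}) (s : seq K) :
  map_poly f q = \prod_(b <- s) ('X - b%:P) ->
  f (\det (horner_mx A q)) =
    (-1) ^+ (n.+1 * size s) * \prod_(b <- s) (map_poly f (char_poly A)).[b].
Proof.
move=> qs; rewrite -det_map_mx map_horner_mx qs.
elim: {qs} s => [|b s IH].
  by rewrite !big_nil rmorph1 det1 muln0 mulr1.
rewrite !big_cons rmorphM /= -[_ * _]/(_ *m _) det_mulmx IH.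
have -> : horner_mx (map_mx f A) ('X - b%:P) = - (b%:M - map_mx f A).
  by rewrite rmorphB /= horner_mx_X horner_mx_C opprB.
rewrite -scaleN1r detZ map_char_poly -horner_evalE -det_map_mx.
have -> : map_mx (horner_eval b) (char_poly_mx (map_mx f A)) = b%:M - map_mx f A.
  apply/matrixP => i j; rewrite !mxE /horner_eval hornerD hornerN hornerC.
  by rewrite hornerMn hornerX.
by rewrite mulnS exprD; ring.
Qed.

(** The norm of [q(theta)] is the resultant of [p] and [q], because multiplication by [theta] has
    characteristic polynomial [p]. *)
Lemma field_norm_split (K : fieldType) (f : {rmorphism k -> K}) (p q : {poly k})
    (s : seq K) :
  monic_irreducible_poly p -> root (p^%) theta -> (size p).-1 = \dim {:L} ->
  map_poly f q = \prod_(b <- s) ('X - b%:P) ->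
  f (field_norm (q^%).[theta]) =
    (-1) ^+ (\dim {:L} * size s) * \prod_(b <- s) (map_poly f p).[b].
Proof.
move=> pI rp sp qs; rewrite -[field_norm _]/(\det (mulmx_of _)).
move: mulmx_of_linear mulmx_ofM mulmx_of1 mulmx_of_inj.
have : (0 < \dim {:L})%N by rewrite adim_gt0.
move: mulmx_of sp; case: (\dim {:L}) => // n M sp _ Ml MM M1 Mi.
by rewrite repr_horner // (det_horner_mx_split _ qs) (repr_char_poly Ml MM M1 Mi pI).
Qed.

End Horner.
End MatrixRepresentation.

(** * Splitting fields and the symmetry of the resultant *)

Lemma irreducible_factor (k : fieldType) (p : {poly k}) : (1 < size p)%N ->
  exists2 q, monic_irreducible_poly q & q %| p.
Proof.
have [n] := ubnP (size p); elim: n p => // n IH p /ltnSE sp p1.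
have p0 : p != 0 by rewrite -size_poly_gt0 (ltn_trans _ p1).
(* Either [p] is irreducible and only has to be made monic, or it has a divisor [q] that is neither
   constant nor associated to [p], hence of smaller size. *)
have [pI|/not_implyP[_ /existsNP[q /not_implyP[q1 /not_implyP[qp /negP nqp]]]]] :=
    EM ((1 < size p)%N -> forall q : {poly k}, size q != 1 -> q %| p -> q %= p).
  have c0 : (lead_coef p)^-1 != 0 by rewrite invr_eq0 lead_coef_eq0.
  exists ((lead_coef p)^-1 *: p); last by rewrite dvdpZl.
  split; last by rewrite monicE lead_coefZ mulVf // lead_coef_eq0.
  split=> [|q q1 qp]; first by rewrite size_scale.
  rewrite dvdpZr // in qp.
  by rewrite (eqp_trans (pI p1 q q1 qp)) // eqp_sym eqp_scale.
have q0 : q != 0 by apply: contraNneq p0 => q0; rewrite q0 dvd0p in qp.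
have sq : (1 < size q)%N.
  by move: q1 q0; rewrite -size_poly_gt0; case: size => [|[]].
have [|//|r rI rq] := IH q.
  apply: leq_trans sp; rewrite ltn_neqAle dvdp_leq // andbT.
  by apply: contra nqp => ?; rewrite -dvdp_size_eqp.
by exists r => //; apply: dvdp_trans qp.
Qed.

(** The class of [X] serves as [theta]: evaluation there is reduction modulo [p], so the matrix
    computations apply to residue fields. *)
Lemma in_qpoly_horner (k : fieldType) (p : {poly k}) (pI : monic_irreducible_poly p)
    (q : {poly k}) :
  (map_poly (in_alg {poly %/ p with pI}) q).[in_qpoly p 'X] = in_qpoly p q.
Proof.
elim/poly_ind: q => [|q c IH]; first by rewrite rmorph0 horner0 in_qpoly0.
rewrite rmorphD rmorphM /= map_polyX map_polyC hornerMXaddC IH in_qpolyD in_qpolyM.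
by congr (_ + _); rewrite /= -alg_polyC in_qpolyZ in_qpoly1.
Qed.

Lemma in_qpoly_eq0 (k : fieldType) (p : {poly k}) (pI : monic_irreducible_poly p)
    (q : {poly k}) : (in_qpoly p q == 0) = (p %| q).
Proof.
have [[p1 _] pm] := pI.
by rewrite -val_eqE /= /mk_monic p1 pm -Pdiv.IdomainMonic.modpE.
Qed.

Lemma root_in_qpoly (k : fieldType) (p : {poly k}) (pI : monic_irreducible_poly p) :
  root (map_poly (in_alg {poly %/ p with pI}) p) (in_qpoly p 'X).
Proof. by rewrite rootE in_qpoly_horner in_qpoly_eq0. Qed.

Lemma dim_qfpoly (k : fieldType) (p : {poly k}) (pI : monic_irreducible_poly p) :
  \dim {: {poly %/ p with pI}} = (size p).-1.
Proof.
have [[p1 _] pm] := pI.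
by rewrite [LHS]dim_polyn /mk_monic p1 pm.
Qed.

(** A root is adjoined in k[X]/(q) for an irreducible factor [q], and the cofactor is split over
    that larger field; hence an induction on the size with [k] varying. *)
Lemma splitting_extension (k : fieldType) (p : {poly k}) : p \is monic ->
  exists (K : fieldType) (f : {rmorphism k -> K}) (s : seq K),
    map_poly f p = \prod_(b <- s) ('X - b%:P).
Proof.
have [n] := ubnP (size p); elim: n k p => // n IH k p /ltnSE sp pm.
have [p1|p1] := leqP (size p) 1.
  exists k, idfun, [::]; rewrite big_nil map_poly_id //.
  by move: pm; rewrite (size1_polyC p1) monicE lead_coefC => /eqP ->.
have [q qI qp] := irreducible_factor p1.
pose E := {poly %/ q with qI}; pose g : {rmorphism k -> E} := in_alg E.
have /factor_theorem[p' e] : root (map_poly g p) (in_qpoly q 'X : E).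
  by rewrite rootE in_qpoly_horner in_qpoly_eq0.
have p'm : p' \is monic.
  by rewrite -(monicMr _ (monicXsubC (in_qpoly q 'X : E))) -e map_monic.
have sp' : (size p' < n)%N.
  apply: leq_trans sp; rewrite -(size_map_poly g p) e.
  by rewrite size_Mmonic ?monic_neq0 ?monicXsubC // size_XsubC addn2.
have [K [f [s es]]] := IH E p' sp' p'm.
exists K, (f \o g), (f (in_qpoly q 'X : E) :: s).
rewrite map_poly_comp e rmorphM /= es big_cons mulrC; congr (_ * _).
by rewrite rmorphB /= map_polyX map_polyC.
Qed.

Lemma field_norm_qpoly_split (k K : fieldType) (f : {rmorphism k -> K})
    (p q : {poly k}) (pI : monic_irreducible_poly p) (s : seq K) :
  map_poly f q = \prod_(b <- s) ('X - b%:P) ->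
  f (field_norm (in_qpoly p q : {poly %/ p with pI})) =
    (-1) ^+ ((size p).-1 * size s) * \prod_(b <- s) (map_poly f p).[b].
Proof.
move=> qs; rewrite -(in_qpoly_horner pI) -(dim_qfpoly pI).
exact: field_norm_split pI (root_in_qpoly pI) (esym (dim_qfpoly pI)) qs.
Qed.

(** The sign is that of Res(q, p) = (-1)^(deg p deg q) Res(p, q), each norm being a resultant of
    monic polynomials. For [p = q] both sides are 0. *)
Lemma resultant_sym (k : fieldType) (p q : {poly k})
    (pI : monic_irreducible_poly p) (qI : monic_irreducible_poly q) :
  field_norm (in_qpoly q p : {poly %/ q with qI}) =
  (-1) ^+ ((size p).-1 * (size q).-1) * field_norm (in_qpoly p q : {poly %/ p with pI}).
Proof.
(* A common field for the roots of both: [p] is split first, then the image of [q]. *)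
have [K1 [f1 [s1 e1]]] := splitting_extension pI.2.
have [|K [f2 [t e2]]] := @splitting_extension K1 (map_poly f1 q).
  by rewrite map_monic qI.2.
pose f : {rmorphism k -> K} := f2 \o f1; pose s := map f2 s1.
have es : map_poly f p = \prod_(b <- s) ('X - b%:P).
  rewrite map_poly_comp e1 rmorph_prod /= big_map; apply: eq_bigr => b _.
  by rewrite rmorphB /= map_polyX map_polyC.
have et : map_poly f q = \prod_(b <- t) ('X - b%:P) by rewrite map_poly_comp.
have ss : (size p).-1 = size s by rewrite -(size_map_poly f) es size_prod_XsubC.
have st : (size q).-1 = size t by rewrite -(size_map_poly f) et size_prod_XsubC.
apply: (fmorph_inj f); rewrite rmorphM rmorphXn rmorphN1.
rewrite (field_norm_qpoly_split qI es) (field_norm_qpoly_split pI et) ss st es et.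
have sgn2 m : (-1) ^+ (m + m) = 1 :> K by rewrite addnn -signr_odd odd_double.
rewrite mulrA -exprD sgn2 mul1r.
(* Turning [b - a] into [a - b] costs one sign for each pair of roots, which cancels the sign of the
   left-hand side. *)
have sgn b (u : seq K) : (\prod_(a <- u) ('X - a%:P)).[b] =
    (-1) ^+ size u * \prod_(a <- u) (a - b).
  elim: u => [|a u IH]; first by rewrite !big_nil hornerC mulr1.
  by rewrite !big_cons /= hornerM IH exprS hornerXsubC; ring.
have {}sgn (u v : seq K) : \prod_(b <- v) (\prod_(a <- u) ('X - a%:P)).[b] =
    (-1) ^+ (size u * size v) * \prod_(b <- v) \prod_(a <- u) (a - b).
  elim: v => [|b v IH]; first by rewrite !big_nil muln0 mulr1.
  by rewrite !big_cons /= IH sgn mulnS exprD; ring.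
rewrite sgn mulrA mulnC -exprD sgn2 mul1r.
rewrite exchange_big; apply: eq_bigr => b _.
by rewrite horner_prod; apply: eq_bigr => a _; rewrite hornerXsubC.
Qed.

(** * Fields with a trivial norm-one group *)

Lemma infinite_poly_eq0 (k L : fieldType) (f : {rmorphism k -> L}) (r : {poly L}) :
  infinite_set [set: k] -> (forall a, root r (f a)) -> r = 0.
Proof.
move=> kinf rr; apply/eqP; apply: contraT => r0.
have [B _ sB] := infinite_set_fset (size r) kinf.
have := @max_poly_roots _ r (map f (finmap.enum_fset B)) r0.
rewrite size_map (map_inj_uniq (fmorph_inj f)) finmap.fset_uniq.
move=> h; have := leq_trans (h _ isT) sB; rewrite ltnn; apply.
by apply/allP => _ /mapP[a _ ->].
Qed.

(* With theta the root of p, (theta - a)^n = N(theta - a) for all a in k; this reads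
   (a - theta)^n = p(a), whence p = (X - theta)^n. *)
Lemma trivial_norm_one_size (k : fieldType) (p : {poly k})
    (pI : monic_irreducible_poly p) :
  infinite_set [set: k] -> separable_poly p ->
  (forall a : {poly %/ p with pI}, field_norm a = 1 -> a = 1) -> size p = 2.
Proof.
move=> kinf psep N1; have [[p1 _] pm] := pI.
apply/eqP; rewrite eqn_leq p1 andbT leqNgt; apply/negP => p2.
pose L : fieldExtType k := {poly %/ p with pI}.
pose theta : L := in_qpoly p 'X; set n := (size p).-1.
have key a : (a%:A - theta) ^+ n = p.[a]%:A :> L.
  pose b : L := in_qpoly p ('X - a%:P).
  have b0 : b != 0.
    suff : ~~ (p %| 'X - a%:P) by rewrite -(in_qpoly_eq0 pI).
    apply/negP => /(dvdp_leq (monic_neq0 (monicXsubC a))).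
    by rewrite size_XsubC leqNgt p2.
  have Nb : field_norm b = (-1) ^+ n * p.[a].
    have := @field_norm_qpoly_split k k idfun p ('X - a%:P) pI [:: a].
    rewrite !map_poly_id // !big_seq1 muln1; exact.
  have bE : b = theta - a%:A.
    by rewrite /b rmorphB /= -[a%:P]alg_polyC in_qpolyZ in_qpoly1.
  (* The scalar [N(b)] has norm [N(b) ^ n], so [b ^ n / N(b)] has norm 1 and therefore equals 1. *)
  have : b ^+ n = (field_norm b)%:A.
    have c0 : field_norm b != 0 by exact: field_norm_neq0.
    have c0' : (field_norm b)%:A != 0 :> L by rewrite scaler_eq0 oner_eq0 orbF.
    apply: (divIf c0'); rewrite [RHS]divff //; apply: N1.
    rewrite field_normM field_normV // field_normX field_norm_scalar.
    by rewrite [\dim _](dim_qfpoly pI) divff // expf_neq0.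
  rewrite Nb bE -opprB (exprNn (a%:A - theta)) => e.
  have s0 : (-1 : L) ^+ n != 0 by rewrite expf_neq0 // oppr_eq0 oner_eq0.
  by apply: (mulfI s0); rewrite e -!in_algE rmorphM rmorphXn rmorphN1.
have pE : map_poly (in_alg L) p = ('X - theta%:P) ^+ n.
  apply/eqP; rewrite -subr_eq0; apply/eqP.
  apply: (infinite_poly_eq0 (f := in_alg L)) => // a.
  by rewrite rootE hornerD hornerN horner_exp hornerXsubC horner_map key subrr.
(* As [n > 1], [theta] is a common root of [p] and its derivative. *)
have : coprimep (map_poly (in_alg L) p) (map_poly (in_alg L) p)^`().
  by rewrite deriv_map coprimep_map; move: psep; rewrite separable_poly.unlock.
have n2 : (1 < n)%N by rewrite /n; lia.
rewrite pE => /(@coprimep_root _ _ _ theta).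
rewrite rootE horner_exp hornerXsubC subrr expr0n eqn0Ngt (ltnW n2) eqxx => /(_ isT).
rewrite deriv_exp derivXsubC mul1r hornerMn horner_exp hornerXsubC subrr expr0n.
by move: n2; case: (n) => [|[]] //= m _; rewrite mul0rn eqxx.
Qed.

(** * Completed fields *)

Section CompletedField.
Local Open Scope quotient_scope.
Variables (F : fieldType) (v : valuation F).
Local Notation K := (completed_field v).
Local Notation w := (completed_valuation v).
Local Notation i := (to_completed_field v).

Lemma to_completionD (a b : local_ring v) :
  to_completion (a + b) = to_completion a + to_completion b.
Proof.
by rewrite /to_completion -rmorphD; congr (\pi_(completion v) _); apply: val_inj.
Qed.

Lemma to_completed_fieldD f g : i (f + g) = i f + i g.
Proof.
have [a [b [b0 ->]]] := local_frac v f; have [c [d [d0 ->]]] := local_frac v g.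
have vb : local_val b != 0 by []. have vd : local_val d != 0 by [].
have D x y : local_val (x + y : local_ring v) = local_val x + local_val y by [].
rewrite addf_div // -!local_valM -D !to_completed_fieldE ?mulf_neq0 //.
by rewrite addf_div ?tofrac_eq0 ?to_completion_eq0 // to_completionD !to_completionM
  tofracD !tofracM.
Qed.

Lemma to_completed_field0 : i 0 = 0.
Proof. by apply: (addrI (i 0)); rewrite -to_completed_fieldD !addr0. Qed.

Lemma to_completed_fieldN f : i (- f) = - i f.
Proof.
by apply: (addrI (i f)); rewrite -to_completed_fieldD !subrr to_completed_field0.
Qed.

Lemma to_completed_fieldB f g : i (f - g) = i f - i g.
Proof. by rewrite to_completed_fieldD to_completed_fieldN. Qed.

Lemma to_completed_field_neq0 f : f != 0 -> i f != 0.
Proof.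
move=> f0; have := to_completed_fieldM v f f^-1.
rewrite divff // to_completed_field1 => e.
by apply: contra_eq_neq e => ->; rewrite mul0r oner_neq0.
Qed.

Lemma to_completion_val (a : local_ring v) : a != 0 ->
  completion_valuation v (to_completion a) = v (local_val a).
Proof.
move=> a0; apply: (@completion_vfunE _ _ _ _ 0) => //.
by rewrite -pi_completion_eq0; rewrite [X in ~~ X]to_completion_eq0.
Qed.

Lemma to_completed_field_val f : f != 0 -> w (i f) = v f.
Proof.
have [a [b [b0 ->]]] := local_frac v f => ab0.
have a0 : a != 0.
  by apply: contraNneq ab0 => ->; rewrite mul0r.
have va : local_val a != 0 by []. have vb : local_val b != 0 by [].
rewrite to_completed_fieldE // [LHS]frac_vfunE ?to_completion_eq0 //.
by rewrite !to_completion_val // valuationM ?invr_neq0 // valuationV.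
Qed.

Lemma to_completed_field_val_ge n f : val_ge w n (i f) = val_ge v n f.
Proof.
have [->|f0] := eqVneq f 0; first by rewrite to_completed_field0 !val_ge0.
by rewrite !val_geE ?to_completed_field_neq0 // to_completed_field_val.
Qed.

(* The termwise quotient of Cauchy sequences representing a and b is Cauchy. *)
Lemma completion_dvd (a b : completion v) : b != 0 ->
  (a == 0) || (completion_valuation v b <= completion_valuation v a) ->
  exists c, a = c * b.
Proof.
have [-> _ _|a0] := eqVneq a 0; first by exists 0; rewrite mul0r.
have [s es] := pi_completion a; have [t et] := pi_completion b.
rewrite {a}es {b}et /= in a0 *; move=> b0; rewrite !pi_completion_eq0 in a0 b0.
have [m [M hM]] := cauchy_val a0; have [n [N hN]] := cauchy_val b0.
rewrite (@completion_vfunE _ _ s m M a0 (fun j Mj => (hM j Mj).2)).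
rewrite (@completion_vfunE _ _ t n N b0 (fun j Nj => (hN j Nj).2)) => nm.
pose P := maxn M N.
pose x j := local_val (seq_val s j); pose y j := local_val (seq_val t j).
have xP j : (P <= j)%N -> x j != 0 /\ v (x j) = m.
  by move=> Pj; apply: hM; apply: leq_trans Pj; exact: leq_maxl.
have yP j : (P <= j)%N -> y j != 0 /\ v (y j) = n.
  by move=> Pj; apply: hN; apply: leq_trans Pj; exact: leq_maxr.
(* Replacing [j] by [maxn P j] avoids the initial terms, where [y] may vanish or the quotient may
   fail to be integral. *)
have q0 j : val_ge v 0 (x (maxn P j) / y (maxn P j)).
  have [x0 vx] := xP _ (leq_maxl P j); have [y0 vy] := yP _ (leq_maxl P j).
  rewrite val_geE ?mulf_neq0 ?invr_neq0 // valuationM ?invr_neq0 // valuationV //.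
  by rewrite vx vy subr_ge0.
pose r j : local_ring v := LocalElt (q0 j).
have rc : cauchy r.
  have /asboolP hs := valP s; have /asboolP ht := valP t.
  (* The denominator [y l' * y j'] has valuation [2 n], so [2 |n|] extra orders of precision are
     asked of both sequences. *)
  apply/asboolP => e; pose E := (e + absz n + absz n)%N.
  have [S hS] := hs E; have [T hT] := ht E.
  exists (maxn S T) => l j; rewrite !geq_max => /andP[Sl Tl] /andP[Sj Tj].
  rewrite /r /=; set l' := maxn P l; set j' := maxn P j.
  have [yl vyl] := yP l' (leq_maxl P l); have [yj vyj] := yP j' (leq_maxl P j).
  have -> : x l' / y l' - x j' / y j' =
      ((x l' - x j') * y j' - x j' * (y l' - y j')) / (y l' * y j').
    by field; rewrite yl yj.
  have Ll u : (u <= l)%N -> (u <= l')%N by move=> /leq_trans; apply; exact: leq_maxr.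
  have Lj u : (u <= j)%N -> (u <= j')%N by move=> /leq_trans; apply; exact: leq_maxr.
  apply: (@val_geW _ _ _ (E%:Z + (- n - n))); first by rewrite /E; lia.
  apply: val_geM; last first.
    rewrite val_geE ?invr_neq0 ?mulf_neq0 // valuationV ?mulf_neq0 // valuationM //.
    by rewrite vyl vyj; lia.
  apply: val_geB.
    by rewrite -[E%:Z]addr0 val_geM ?local_ge0 // hS ?Ll ?Lj.
  by rewrite -[E%:Z]add0r val_geM ?local_ge0 // hT ?Ll ?Lj.
exists (\pi_(completion v) (CauchySeq rc)); apply/eqP.
rewrite -rmorphM pi_completion_eq; apply/asboolP => e; exists P => j Pj.
have -> : local_val (seq_val (s - CauchySeq rc * t) j) =
    x j - (x (maxn P j) / y (maxn P j)) * y j.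
  by [].
by rewrite (maxn_idPr Pj) divfK ?subrr ?val_ge0 //; case: (yP j Pj).
Qed.

(** By [completion_dvd] applied to a numerator and a denominator, the completed local ring is the
    whole valuation ring of its fraction field. Integrality of ideles can thus be read on
    valuations. *)
Lemma completed_field_integer (a : K) : val_ge w 0 a -> exists b, a = b%:F.
Proof.
have [x [y [y0 -> va]]] := fracP (completion_valuation v) a => h.
have [|c ->] := @completion_dvd x y y0; last first.
  by exists c; rewrite tofracM mulfK // tofrac_eq0.
have [//|x0 /=] := eqVneq x 0.
move: h; rewrite val_geE ?mulf_neq0 ?invr_eq0 ?tofrac_eq0 //.
by rewrite [vfun _ _]va subr_ge0.
Qed.

(** The approximation is a term of a representing Cauchy sequence, taken beyond the rank where
    differences have valuation at least 1. Hence the default of [xget] in [residue] is never reached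
    on integral elements. *)
Lemma completed_field_approx (a : K) : val_ge w 0 a ->
  exists2 f, val_ge v 0 f & val_ge w 1 (a - i f).
Proof.
move=> /completed_field_integer[b ->]; have [s ->] := pi_completion b.
have /asboolP /(_ 1%N)[N hN] := valP s.
pose u := seq_val s N; exists (local_val u); first exact: local_ge0.
have -> : i (local_val u) = (to_completion u)%:F.
  have := @to_completed_fieldE _ _ u 1 (oner_neq0 _).
  have -> : local_val (1 : local_ring v) = 1 by [].
  have -> : to_completion (1 : local_ring v) = 1.
    by rewrite /to_completion -[RHS](rmorph1 (\pi_(completion v)));
      congr (\pi_(completion v) _); apply: val_inj.
  by rewrite divr1 tofrac1 divr1.
rewrite -tofracB.
pose d := s - CauchySeq (cauchy_cst u).
have -> : \pi_(completion v) s - to_completion u = \pi_(completion v) d.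
  by rewrite /to_completion -rmorphB.
have [/eqP ->|d0] := boolP (\pi_(completion v) d == 0).
  by rewrite tofrac0 val_ge0.
rewrite val_geE ?tofrac_eq0 // -[_%:F]divr1 -tofrac1 [vfun _ _]frac_vfunE ?oner_neq0 //.
rewrite valuation1 subr0.
rewrite pi_completion_eq0 in d0; have [m [M hM]] := cauchy_val d0.
rewrite [vfun _ _](@completion_vfunE _ _ d m M d0 (fun j Mj => (hM j Mj).2)).
have [d'0 <-] := hM (maxn M N) (leq_maxl _ _).
rewrite -val_geE //; exact: hN (leq_maxr _ _) (leqnn _).
Qed.

End CompletedField.

(** * Values of functions at closed points *)

(** This names the representative from which [value_at] is computed. *)
Lemma frac_numden (R : idomainType) (f : {fraction R}) :
  f = (\n_(repr f))%:F / (\d_(repr f))%:F.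
Proof.
have d0 := denom_ratioP (repr f).
apply: (canRL (mulfK _)); first by rewrite tofrac_eq0.
rewrite -{1}[f]reprK; move: (repr f) d0 => r d0.
unlock FracField.tofrac; rewrite -[LHS]FracField.pi_mul.
apply/eqP; rewrite eqmodE /= /FracField.equivf.
by rewrite /FracField.mulf !numden_Ratio ?mulr1 ?mulf_neq0 ?oner_neq0 // mulrC.
Qed.

Lemma frac_val_ge (R : idomainType) (v : valuation R) n (a b : R) : b != 0 ->
  val_ge (frac_valuation v) n (a%:F / b%:F) = (a == 0) || (n <= v a - v b).
Proof.
move=> b0; have [->|a0] := eqVneq a 0; first by rewrite tofrac0 mul0r val_ge0.
by rewrite val_geE ?mulf_neq0 ?invr_eq0 ?tofrac_eq0 // [vfun _ _]frac_vfunE.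
Qed.

(** Here [m] and [n] only bound the degrees, so that a top coefficient may vanish, as for a function
    with a zero at infinity. *)
Lemma coefM_top (R : nzRingType) (a b : {poly R}) m n :
  (size a <= m.+1)%N -> (size b <= n.+1)%N -> (a * b)`_(m + n) = a`_m * b`_n.
Proof.
move=> am bn; rewrite coefM (bigD1 (inord m)) //= inordK; last by rewrite ltnS leq_addr.
rewrite addKn big1 ?addr0 // => i; rewrite -val_eqE /= inordK ?ltnS ?leq_addr // => im.
have [lt_mi|le_im] := ltnP m i.
  by rewrite nth_default ?mul0r // (leq_trans am).
rewrite [b`__]nth_default ?mulr0 //; apply: leq_trans bn _.
by move: im le_im (ltn_ord i); lia.
Qed.

Section Values.
Variable k : fieldType.

Section Affine.
Variables (p : {poly k}) (pI : monic_irreducible_poly p).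
Local Notation x := (AffinePoint pI).
Local Notation "[ q ]" := (in_qpoly p q : residue_field x) (at level 0).

Lemma poly_order_ge1 (a : {poly k}) : a != 0 -> (0 < poly_order p a)%N = (p %| a).
Proof.
move=> a0; have [b [{2}-> pb]] := poly_orderP pI.1 a0.
by case: poly_order => [|n]; rewrite ?mulr1 ?(negbTE pb) // exprS mulrCA dvdp_mulr.
Qed.

Lemma poly_order_ndvd (a : {poly k}) : ~~ (p %| a) -> poly_order p a = 0%N.
Proof. by move=> pa; have := poly_orderE pI.1 0 pa; rewrite mulr1. Qed.

Lemma affine_integer (f : function_field k) : val_ge (point_valuation x) 0 f ->
  exists a b : {poly k}, ~~ (p %| b) /\ f = a%:F / b%:F.
Proof.
have p0 := irredp_neq0 pI.1.
have p1 : ~~ (p %| 1) by rewrite dvdp1 neq_ltn pI.1.1 orbT.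
rewrite (frac_numden f); have := denom_ratioP (repr f).
move: (\n_(repr f)) (\d_(repr f)) => a b b0; rewrite frac_val_ge //.
have [->|a0] := eqVneq a 0.
  by exists 0, 1; rewrite p1 tofrac0 !mul0r.
have [a' [ea pa]] := poly_orderP pI.1 a0; have [b' [eb pb]] := poly_orderP pI.1 b0.
rewrite subr_ge0 /= => ba; exists (a' * p ^+ (poly_order p a - poly_order p b)), b'.
split=> //; have b'0 : b' != 0 by apply: contraNneq pb => ->; rewrite dvdp0.
apply/eqP; rewrite eqr_div ?tofrac_eq0 // -!tofracM tofrac_eq {1}ea {2}eb.
rewrite -{1}(subnK (_ : poly_order p b <= poly_order p a)%N) // exprD.
by apply/eqP; ring.
Qed.

Lemma affine_val_ge1 (a b : {poly k}) : ~~ (p %| b) ->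
  val_ge (point_valuation x) 1 (a%:F / b%:F) = (p %| a).
Proof.
move=> pb; have b0 : b != 0 by apply: contraNneq pb => ->; rewrite dvdp0.
rewrite frac_val_ge //=; have [->|a0] := eqVneq a 0; first by rewrite dvdp0.
by rewrite (poly_order_ndvd pb) subr0 -poly_order_ge1.
Qed.

(** Any fraction with denominator prime to [p] may be used, although [value_at] reduces a chosen
    representative to lowest terms. *)
Lemma value_affineE (a b : {poly k}) : ~~ (p %| b) ->
  value_at x (a%:F / b%:F) = [a] / [b].
Proof.
move=> pb; have b0 : b != 0 by apply: contraNneq pb => ->; rewrite dvdp0.
set f : function_field k := _ / _; rewrite /value_at.
have /eqP := frac_numden f; rewrite {1}/f.
have := denom_ratioP (repr f).
move: (\n_(repr f)) (\d_(repr f)) => a' b' b'0.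
rewrite eqr_div ?tofrac_eq0 // -!tofracM tofrac_eq => /eqP e.
set g := gcdp a' b'; have g0 : g != 0 by rewrite gcdp_eq0 negb_and b'0 orbT.
have ea : a' = a' %/ g * g by rewrite divpK // dvdp_gcdl.
have eb : b' = b' %/ g * g by rewrite divpK // dvdp_gcdr.
move: e; rewrite {1}eb {1}ea => e.
have {}e : a' %/ g * b = a * (b' %/ g) by apply: (mulIf g0); rewrite mulrAC -e; ring.
(* If [p] divided the reduced denominator, it would be prime to [a' %/ g] and divide [a' %/ g * b],
   hence divide [b]. *)
have pb' : ~~ (p %| b' %/ g).
  have cop : coprimep (b' %/ g) (a' %/ g).
    rewrite coprimep_sym; apply: coprimep_div_gcd; by rewrite b'0 orbT.
  apply: contra pb => pb'; rewrite -(@Gauss_dvdpr _ b (a' %/ g) p).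
    by rewrite e dvdp_mull.
  by apply: coprimep_dvdr cop.
have B0 : [b] != 0 by rewrite (in_qpoly_eq0 pI).
have B'0 : [b' %/ g] != 0 by rewrite (in_qpoly_eq0 pI).
apply/eqP; rewrite eqr_div //; apply/eqP.
by have := congr1 (in_qpoly p) e; rewrite !in_qpolyM.
Qed.

End Affine.

Section Infinity.
Local Notation x := (PointAtInfinity k).

Lemma infty_integer (f : function_field k) : val_ge (point_valuation x) 0 f ->
  exists a b : {poly k}, [/\ b != 0, (size a <= size b)%N & f = a%:F / b%:F].
Proof.
rewrite (frac_numden f); have := denom_ratioP (repr f).
move: (\n_(repr f)) (\d_(repr f)) => a b b0; rewrite frac_val_ge //= => h.
exists a, b; split=> //; move: h b0; have [->|a0] := eqVneq a 0.
  by rewrite size_poly0.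
move: a0; rewrite -!size_poly_gt0 /=; move: (size a) (size b) => m n; lia.
Qed.

Lemma infty_val_ge1 (a b : {poly k}) : b != 0 -> (size a <= size b)%N ->
  val_ge (point_valuation x) 1 (a%:F / b%:F) = (a`_(size b).-1 == 0).
Proof.
move=> b0 ab; rewrite frac_val_ge //=.
have [->|a0] := eqVneq a 0; first by rewrite coef0 eqxx.
move: b0 a0; rewrite -!size_poly_gt0 => b0 a0 /=.
have [eab|nab] := eqVneq (size a) (size b).
  by rewrite -eab -lead_coefE lead_coef_eq0 -size_poly_eq0 opprK addNr eqn0Ngt a0.
have lt_ab : (size a < size b)%N by lia.
rewrite nth_default ?eqxx; last by rewrite -ltnS prednK.
by apply/idP; move: (size a) (size b) a0 b0 lt_ab => m n; lia.
Qed.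

Lemma value_inftyE (a b : {poly k}) : b != 0 -> (size a <= size b)%N ->
  value_at x (a%:F / b%:F) = a`_(size b).-1 / lead_coef b.
Proof.
move=> b0 ab; set f : function_field k := _ / _; rewrite /value_at.
have /eqP := frac_numden f; rewrite {1}/f.
have := denom_ratioP (repr f).
move: (\n_(repr f)) (\d_(repr f)) => a' b' b'0.
rewrite eqr_div ?tofrac_eq0 // -!tofracM tofrac_eq => /eqP e.
have sb := b0; have sb' := b'0; rewrite -!size_poly_gt0 in sb sb'.
have ab' : (size a' <= size b')%N.
  have [->|a'0] := eqVneq a' 0; first by rewrite size_poly0.
  have a0 : a != 0.
    by apply: contra_eq_neq e => ->; rewrite mul0r eq_sym mulf_neq0.
  have := congr1 (size : {poly k} -> nat) e; rewrite !size_mul //.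
  move: a'0 a0 sb sb' ab; rewrite -!size_poly_gt0.
  by move: (size a) (size b) (size a') (size b') => m n m' n'; lia.
apply/eqP; rewrite eqr_div ?lead_coef_eq0 //; apply/eqP.
rewrite !lead_coefE -coefM_top ?prednK // -e.
by rewrite -coefM_top ?prednK // addnC.
Qed.

End Infinity.

Implicit Types (x : closed_point k) (f g : function_field k).

Lemma value_at1 x : value_at x 1 = 1.
Proof.
rewrite -[1]divr1 -tofrac1; case: x => [p pI|].
  by rewrite value_affineE ?in_qpoly1 ?divr1 // dvdp1 neq_ltn pI.1.1 orbT.
by rewrite value_inftyE ?oner_neq0 // size_poly1 coef1 lead_coef1 divr1.
Qed.

Lemma value_atM x f g : val_ge (point_valuation x) 0 f ->
  val_ge (point_valuation x) 0 g -> value_at x (f * g) = value_at x f * value_at x g.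
Proof.
case: x => [p pI|].
  move=> /affine_integer[a [b [pb ->]]] /affine_integer[c [d [pd ->]]].
  rewrite mulf_div -!tofracM !value_affineE ?irredp_dvdM ?negb_or ?pb //; last exact: pI.1.
  by rewrite !in_qpolyM mulf_div.
move=> /infty_integer[a [b [b0 ab ->]]] /infty_integer[c [d [d0 cd ->]]].
have sb := b0; have sd := d0; rewrite -!size_poly_gt0 in sb sd.
have e : (size (b * d)).-1 = ((size b).-1 + (size d).-1)%N.
  by rewrite size_mul //; move: sb sd; move: (size b) (size d) => m n; lia.
rewrite mulf_div -!tofracM !value_inftyE ?mulf_neq0 //.
  by rewrite e coefM_top ?prednK // lead_coefM mulf_div.
apply: leq_trans (size_polyMleq a c) _; rewrite (size_mul b0 d0).
move: (size_polyMleq a c) ab cd sb sd.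
move: (size a) (size b) (size c) (size d) (size (a * c)) => m n m' n' l; lia.
Qed.

Lemma value_atB x f g : val_ge (point_valuation x) 0 f ->
  val_ge (point_valuation x) 0 g -> value_at x (f - g) = value_at x f - value_at x g.
Proof.
case: x => [p pI|].
  move=> /affine_integer[a [b [pb ->]]] /affine_integer[c [d [pd ->]]].
  have b0 : b != 0 by apply: contraNneq pb => ->; rewrite dvdp0.
  have d0 : d != 0 by apply: contraNneq pd => ->; rewrite dvdp0.
  rewrite -mulNr addf_div ?tofrac_eq0 // mulNr -!tofracM -tofracB.
  rewrite !value_affineE ?irredp_dvdM ?negb_or ?pb //; last exact: pI.1.
  rewrite -[in RHS]mulNr addf_div ?(in_qpoly_eq0 pI) //.
  by rewrite mulNr rmorphB /= !in_qpolyM.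
move=> /infty_integer[a [b [b0 ab ->]]] /infty_integer[c [d [d0 cd ->]]].
have sb := b0; have sd := d0; rewrite -!size_poly_gt0 in sb sd.
have e : (size (b * d)).-1 = ((size b).-1 + (size d).-1)%N.
  by rewrite size_mul //; move: sb sd; move: (size b) (size d) => m n; lia.
rewrite -mulNr addf_div ?tofrac_eq0 // mulNr -!tofracM -tofracB.
rewrite !value_inftyE ?mulf_neq0 //; last first.
  rewrite (leq_trans (size_polyD _ _)) // size_polyN geq_max (size_mul b0 d0).
  move: (size_polyMleq a d) (size_polyMleq c b) ab cd sb sd.
  move: (size a) (size b) (size c) (size d) (size (a * d)) (size (c * b)).
  by move=> m n m' n' l l'; lia.
rewrite e coefB coefM_top ?prednK // addnC coefM_top ?prednK // lead_coefM.
by rewrite -!lead_coefE -[in RHS]mulNr addf_div ?lead_coef_eq0 // mulNr.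
Qed.

(** With [value_atM] and [value_atB], this makes [value_at] the reduction homomorphism of the local
    ring, with kernel the maximal ideal. *)
Lemma value_at_eq0 x f : val_ge (point_valuation x) 0 f ->
  (value_at x f == 0) = val_ge (point_valuation x) 1 f.
Proof.
case: x => [p pI|].
  move=> /affine_integer[a [b [pb ->]]].
  rewrite affine_val_ge1 // value_affineE // mulf_eq0 invr_eq0.
  by rewrite !(in_qpoly_eq0 pI) (negbTE pb) orbF.
move=> /infty_integer[a [b [b0 ab ->]]].
rewrite infty_val_ge1 // value_inftyE // mulf_eq0 invr_eq0 lead_coef_eq0.
by rewrite (negbTE b0) orbF.
Qed.

End Values.

(** * Residues and local pairings *)

Lemma subrBB (V : zmodType) (a b c : V) : b - c = (a - c) - (a - b).
Proof. by rewrite opprB [RHS]addrC addrA subrK. Qed.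

Lemma mulrBB (R : pzRingType) (a b c d : R) :
  a * b - c * d = a * (b - d) + (a - c) * d.
Proof. by rewrite mulrBr mulrBl addrA subrK. Qed.

(** The exponents of the signs add, and [R] is multiplicative on the two symbols because these are
    integral. This is one half of the bimultiplicativity of the tame symbol. *)
Lemma symbolM (F K : fieldType) (v : valuation F) (d : int) (R : F -> K) a b c :
  (forall s t, val_ge v 0 s -> val_ge v 0 t -> R (s * t) = R s * R t) ->
  a != 0 -> b != 0 -> c != 0 ->
  (-1) ^ (d * v (a * b) * v c) * R ((a * b) ^ v c / c ^ v (a * b)) =
  (-1) ^ (d * v a * v c) * R (a ^ v c / c ^ v a) *
    ((-1) ^ (d * v b * v c) * R (b ^ v c / c ^ v b)).
Proof.
move=> RM a0 b0 c0; rewrite valuationM //.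
have N1 : (-1 : K) != 0 by rewrite oppr_eq0 oner_neq0.
rewrite mulrACA -expfzDr // -RM ?symbol_ge0 //.
rewrite mulrDr mulrDl; congr (_ * R _).
by rewrite expfzMl expfzDr // invfM mulrACA.
Qed.

Section Residues.
Variables (k : fieldType) (x : closed_point k).
Local Notation v := (point_valuation x).
Local Notation w := (local_valuation x).
Implicit Types (a b : local_field x) (f g : function_field k).

Lemma diagonal_ge n f : val_ge w n (diagonal x f) = val_ge v n f.
Proof. exact: to_completed_field_val_ge. Qed.

Lemma diagonal_val f : f != 0 -> w (diagonal x f) = v f.
Proof. exact: to_completed_field_val. Qed.

Lemma diagonal_neq0 f : f != 0 -> diagonal x f != 0.
Proof. exact: to_completed_field_neq0. Qed.

Lemma diagonalM f g : diagonal x (f * g) = diagonal x f * diagonal x g.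
Proof. exact: to_completed_fieldM. Qed.

Lemma diagonalB f g : diagonal x (f - g) = diagonal x f - diagonal x g.
Proof. exact: to_completed_fieldB. Qed.

Lemma diagonal1 : diagonal x 1 = 1.
Proof. exact: to_completed_field1. Qed.

(** Two functions approximating [a] differ by an element of the maximal ideal, so they have the same
    value and the choice made in [residue] is immaterial. *)
Lemma residueE a f : val_ge w 0 a -> val_ge w 1 (a - diagonal x f) ->
  val_ge v 0 f /\ residue a = value_at x f.
Proof.
move=> a0 af; have ge0 g : val_ge w 1 (a - diagonal x g) -> val_ge v 0 g.
  move=> ag; rewrite -diagonal_ge.
  have -> : diagonal x g = a - (a - diagonal x g) by rewrite subKr.
  by apply: val_geB a0 _; apply: val_geW ag.
have f0 := ge0 _ af; split=> //; rewrite /residue.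
case: xgetP => [g _ ag|/(_ f) []]; last exact: af.
have {}ag : val_ge w 1 (a - diagonal x g) by exact: ag.
have g0 := ge0 _ ag; apply/eqP; rewrite -subr_eq0 -value_atB //.
rewrite value_at_eq0; last exact: val_geB.
rewrite -diagonal_ge diagonalB.
rewrite (subrBB a); exact: val_geB af ag.
Qed.

Lemma residue_approx a : val_ge w 0 a -> exists f,
  [/\ val_ge v 0 f, val_ge w 1 (a - diagonal x f) & residue a = value_at x f].
Proof.
move=> a0; have [f f0 af] := completed_field_approx a0.
by exists f; split=> //; have [] := residueE a0 af.
Qed.

Lemma residue_diagonal f : val_ge v 0 f -> residue (diagonal x f) = value_at x f.
Proof.
move=> f0; have := @residueE (diagonal x f) f.
by rewrite subrr val_ge0 diagonal_ge => /(_ f0 isT)[].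
Qed.

Lemma residue1 : residue (1 : local_field x) = 1.
Proof. by rewrite -diagonal1 residue_diagonal ?val_ge1 // value_at1. Qed.

Lemma residueM a b : val_ge w 0 a -> val_ge w 0 b ->
  residue (a * b) = residue a * residue b.
Proof.
move=> a0 b0; have [f [f0 af ->]] := residue_approx a0.
have [g [g0 bg ->]] := residue_approx b0; rewrite -value_atM //.
have ab0 : val_ge w 0 (a * b) by rewrite -[0%R]addr0 val_geM.
apply: (residueE ab0 _).2; rewrite diagonalM.
rewrite mulrBB.
apply: val_geD.
  rewrite -[1%R : int]add0r; exact: val_geM a0 bg.
rewrite -[1%R : int]addr0; apply: (val_geM af); rewrite diagonal_ge; exact: g0.
Qed.

Lemma residue_eq1 a : val_ge w 0 a -> (residue a == 1) = one_unit w a.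
Proof.
move=> a0; have [f [f0 af ->]] := residue_approx a0.
rewrite -subr_eq0 -(value_at1 x) -value_atB ?val_ge1 //.
rewrite value_at_eq0; last exact: val_geB (val_ge1 _).
rewrite -diagonal_ge diagonalB diagonal1 /one_unit.
apply/idP/idP => h.
  have -> : a - 1 = (a - diagonal x f) + (diagonal x f - 1) by rewrite addrA subrK.
  exact: val_geD af h.
rewrite (subrBB a); exact: val_geB h af.
Qed.

(** The valuative form of [local_unit]: stability under products and inverses is immediate, without
    exhibiting elements of the completed ring. *)
Definition integral_unit a := (a != 0) && (w a == 0).

Lemma integral_unit_ge0 a : integral_unit a -> val_ge w 0 a.
Proof. by case/andP=> a0 /eqP va; rewrite val_geE // va. Qed.

Lemma integral_unitV a : integral_unit a -> integral_unit a^-1.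
Proof.
by case/andP=> a0 /eqP va; rewrite /integral_unit invr_neq0 // valuationV // va.
Qed.

Lemma integral_unitM a b :
  integral_unit a -> integral_unit b -> integral_unit (a * b).
Proof.
case/andP=> a0 /eqP va /andP[b0 /eqP vb]; apply/andP; split.
  exact: mulf_neq0 a0 b0.
by rewrite (valuationM w a0 b0) va vb.
Qed.

Lemma integral_unitP a : integral_unit a -> local_unit a.
Proof.
move=> ua; have [b eb] := completed_field_integer (integral_unit_ge0 ua).
have [c ec] := completed_field_integer (integral_unit_ge0 (integral_unitV ua)).
exists b => //; apply/unitrPr; exists c; apply/eqP.
rewrite -tofrac_eq tofracM -eb -ec tofrac1 divff //.
by case/andP: ua.
Qed.

Lemma local_unit_integral a : local_unit a -> integral_unit a.
Proof.
move=> [b ub ->]; have b0 : b%:F != 0 :> local_field x.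
  by rewrite tofrac_eq0; apply: contraTneq ub => ->; rewrite unitr0.
rewrite /integral_unit b0 /=; apply/eqP.
apply: (@valuation_unit _ w b%:F (b^-1)%:F).
- by rewrite -tofracM mulrV // tofrac1.
- by apply: local_integer_ge0; exists b.
- by apply: local_integer_ge0; exists b^-1.
Qed.

Lemma residue_unit_neq0 a : integral_unit a -> residue a != 0.
Proof.
move=> ua; have := residueM (integral_unit_ge0 ua) (integral_unit_ge0 (integral_unitV ua)).
rewrite divff; last by case/andP: ua.
by rewrite residue1 => e; apply: contra_eq_neq e => ->; rewrite mul0r oner_neq0.
Qed.

Lemma residueV a : integral_unit a -> residue a^-1 = (residue a)^-1.
Proof.
move=> ua; have r0 := residue_unit_neq0 ua; apply: (mulfI r0).
rewrite -residueM ?integral_unit_ge0 ?integral_unitV // !divff ?residue1 //.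
by case/andP: ua.
Qed.

Lemma integral_unitX a n : integral_unit a -> integral_unit (a ^+ n).
Proof.
case/andP=> a0 /eqP va; rewrite /integral_unit expf_neq0 //.
by have := valuationXz w n%:Z a0; rewrite va mulr0 => /eqP.
Qed.

Lemma residueX a n : integral_unit a -> residue (a ^+ n) = residue a ^+ n.
Proof.
move=> ua; elim: n => [|n IH]; first by rewrite !expr0 residue1.
by rewrite !exprS residueM ?IH // integral_unit_ge0 // integral_unitX.
Qed.

Lemma residue_norm_expz a (n : int) : integral_unit a ->
  field_norm (residue (a ^ n)) = field_norm (residue a) ^ n.
Proof.
move=> ua; case: n => n; first by rewrite residueX // field_normX.
rewrite NegzE -[a ^ _]/((a ^+ n.+1)^-1) residueV ?integral_unitX //.
by rewrite field_normV ?residue_unit_neq0 ?integral_unitX // residueX // field_normX.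
Qed.

Lemma local_pairingM a b c : a != 0 -> b != 0 -> c != 0 ->
  local_pairing (a * b) c = local_pairing a c * local_pairing b c.
Proof.
apply: (symbolM (point_degree x)%:Z (R := fun c => field_norm (residue c))) => s t s0 t0.
by rewrite (residueM s0 t0); exact: field_normM.
Qed.

(** When [w a = 0], the sign and the power of [b] disappear from the tame symbol. *)
Lemma local_pairing_unit a b : integral_unit a -> 
  local_pairing a b = field_norm (residue a) ^ w b.
Proof.
move=> ua; have /andP[a0 /eqP va] := ua; rewrite /local_pairing va.
by rewrite mulr0 mul0r !expr0z mul1r divr1; exact: residue_norm_expz ua.
Qed.

Lemma local_pairing_one a b : integral_unit a -> integral_unit b ->
  local_pairing a b = 1.
Proof. by move=> ua /andP[_ /eqP vb]; rewrite local_pairing_unit // vb. Qed.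

End Residues.

(** * Ideles *)

Lemma fsbig_setT_seq (T : choiceType) (R : Type) (idx : R) (op : Monoid.com_law idx)
    (r : seq T) (f : T -> R) :
  uniq r -> (forall x, x \notin r -> f x = idx) ->
  \big[op/idx]_(x \in [set: T]) f x = \big[op/idx]_(x <- r) f x.
Proof.
move=> ur fr; rewrite (@fsbigE _ _ op _ _ r) // => [|x _]; last exact: fr.
by apply: eq_bigl => x; rewrite in_setT.
Qed.

Section Global.
Variable k : fieldType.
Implicit Types (x : closed_point k) (alpha beta gamma : idele k) (f g : function_field k).

Lemma idele_integral_unit alpha x :
  local_valuation x (alpha x) = 0 -> integral_unit (alpha x).
Proof. by move=> v0; apply/andP; split; [exact: idele_neq0 | apply/eqP]. Qed.

Lemma idele_mulE alpha beta x : (alpha * beta)%g x = alpha x * beta x.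
Proof. by []. Qed.

Lemma idele_invE alpha x : (alpha^-1)%g x = (alpha x)^-1.
Proof. by []. Qed.

Lemma idele_valM alpha beta x : local_valuation x ((alpha * beta)%g x) =
  local_valuation x (alpha x) + local_valuation x (beta x).
Proof. exact: valuationM (idele_neq0 alpha x) (idele_neq0 beta x). Qed.

Lemma idele_valV alpha x :
  local_valuation x ((alpha^-1)%g x) = - local_valuation x (alpha x).
Proof. exact: valuationV (idele_neq0 alpha x). Qed.

Lemma idele_pairing_seq (r : seq (closed_point k)) alpha beta : uniq r ->
  (forall x, x \notin r -> local_valuation x (alpha x) = 0) ->
  (forall x, x \notin r -> local_valuation x (beta x) = 0) ->
  idele_pairing alpha beta = \prod_(x <- r) local_pairing (alpha x) (beta x).
Proof.
move=> ur ra rb; apply: fsbig_setT_seq => // x xr.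
apply: local_pairing_one; apply: idele_integral_unit; [exact: ra | exact: rb].
Qed.

Lemma idele_val_seq (alpha : idele k) : exists r : seq (closed_point k),
  forall x, x \notin r -> local_valuation x (alpha x) = 0.
Proof.
have /finite_seqP[r er] := idele_val_finite alpha; exists r => x xr.
apply: contrapT => vx; move: xr; have : [set` r]%classic x by rewrite -er.
by rewrite /= => ->.
Qed.

Lemma idele_pairingM alpha beta gamma :
  idele_pairing (alpha * beta)%g gamma =
  idele_pairing alpha gamma * idele_pairing beta gamma.
Proof.
have [ra ha] := idele_val_seq alpha; have [rb hb] := idele_val_seq beta.
have [rc hc] := idele_val_seq gamma; pose r := undup (ra ++ rb ++ rc).
have Hr x : x \notin r -> [/\ x \notin ra, x \notin rb & x \notin rc].
  by rewrite mem_undup !mem_cat !negb_or => /and3P[].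
have Ha x : x \notin r -> local_valuation x (alpha x) = 0 by move=> /Hr[/ha].
have Hb x : x \notin r -> local_valuation x (beta x) = 0 by move=> /Hr[_ /hb].
have Hc x : x \notin r -> local_valuation x (gamma x) = 0 by move=> /Hr[_ _ /hc].
have Hab x : x \notin r -> local_valuation x ((alpha * beta)%g x) = 0.
  by move=> xr; rewrite idele_valM (Ha x xr) (Hb x xr).
rewrite (idele_pairing_seq (undup_uniq _) Ha Hc) (idele_pairing_seq (undup_uniq _) Hb Hc).
rewrite (idele_pairing_seq (undup_uniq _) Hab Hc) -big_split /=.
apply: eq_bigr => x _.
exact: local_pairingM (idele_neq0 alpha x) (idele_neq0 beta x) (idele_neq0 gamma x).
Qed.

Lemma idele_pairing1 gamma : idele_pairing 1%g gamma = 1.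
Proof.
apply: fsbig1 => x _; have u1 : integral_unit ((1%g : idele k) x).
  by apply: idele_integral_unit; exact: valuation1.
by rewrite local_pairing_unit // residue1 field_norm1 exp1rz.
Qed.

Lemma idele_pairingV alpha gamma :
  idele_pairing alpha gamma = 1 -> idele_pairing (alpha^-1)%g gamma = 1.
Proof.
move=> e; have := idele_pairingM (alpha^-1)%g alpha gamma.
by rewrite mulVg idele_pairing1 e mulr1 => ->.
Qed.

(** The list [r] bounds the divisor of [f]: outside it both [f] and its inverse are integral. *)
Lemma diagonal_idele f (r : seq (closed_point k)) : f != 0 ->
  (forall x, x \notin r -> point_valuation x f = 0) ->
  exists alpha : idele k, is_diagonal f alpha.
Proof.
have int g : g != 0 -> (forall x, x \notin r -> point_valuation x g = 0) ->
    adele (fun x => diagonal x g).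
  move=> g0 hg; apply: sub_finite_set (finite_seq r) => x /= ni.
  apply: contrapT => /negP xr; apply: ni.
  by apply: completed_field_integer; rewrite diagonal_ge val_geE // hg.
move=> f0 hf.
have fV0 : f^-1 != 0 by rewrite invr_eq0.
have hV x : x \notin r -> point_valuation x f^-1 = 0.
  by move=> /hf; rewrite valuationV // => ->; rewrite oppr0.
have unit : exists2 b, adele b & forall x, diagonal x f * b x = 1.
  exists (fun x => diagonal x f^-1); first exact: int.
  by move=> x; rewrite -diagonalM divff // diagonal1.
by exists (Idele (int f f0 hf) unit).
Qed.

Lemma idele_degree_seq (r : seq (closed_point k)) alpha : uniq r ->
  (forall x, x \notin r -> local_valuation x (alpha x) = 0) ->
  idele_degree alpha = \sum_(x <- r) (point_degree x)%:Z * local_valuation x (alpha x).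
Proof. by move=> ur h; apply: fsbig_setT_seq => // x /h ->; rewrite mulr0. Qed.

Lemma point_degree_affine (p : {poly k}) (pI : monic_irreducible_poly p) :
  point_degree (AffinePoint pI) = (size p).-1.
Proof. exact: dim_qfpoly. Qed.

Lemma point_degree_infty : point_degree (PointAtInfinity k) = 1%N.
Proof. by rewrite /point_degree /= regular_fullv dimv1. Qed.

(** The residue field is [k^o], of dimension 1 over [k], where every element is a scalar. *)
Lemma field_norm_infty (c : residue_field (PointAtInfinity k)) : field_norm c = c.
Proof.
have := @field_norm_scalar k (residue_field (PointAtInfinity k)) c.
by rewrite [\dim _]point_degree_infty expr1 /GRing.scale /= mulr1.
Qed.

Lemma affine_inf_neq (p : {poly k}) (pI : monic_irreducible_poly p) :
  (AffinePoint pI == PointAtInfinity k) = false.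
Proof. by apply/negbTE/eqP. Qed.

Lemma affine_point_eq (p q : {poly k}) (pI : monic_irreducible_poly p)
    (qI : monic_irreducible_poly q) : p = q -> AffinePoint pI = AffinePoint qI.
Proof.
move=> pq; subst q; congr AffinePoint; case: pI qI => [a b] [c d].
by congr pair; exact: Prop_irrelevance.
Qed.

Lemma affine_pointE (p q : {poly k}) (pI : monic_irreducible_poly p)
    (qI : monic_irreducible_poly q) : (AffinePoint pI == AffinePoint qI) = (q %| p).
Proof.
apply/eqP/idP => [[->]//|qp]; apply: affine_point_eq.
apply/eqP; rewrite eq_sym -(eqp_monic qI.2 pI.2); apply: pI.1.2 => //.
by rewrite neq_ltn qI.1.1 orbT.
Qed.

Lemma point_valuation_poly x (a : {poly k}) : a != 0 ->
  point_valuation x a%:F = poly_valuation x a.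
Proof.
move=> a0; rewrite -[a%:F]divr1 -tofrac1 [LHS]frac_vfunE ?oner_neq0 //.
by rewrite valuation1 subr0.
Qed.

Lemma affine_valuation (p : {poly k}) (pI : monic_irreducible_poly p) x :
  point_valuation x p%:F =
    if x is AffinePoint q qI then (x == AffinePoint pI)%:Z else - (size p).-1%:Z.
Proof.
have p0 := irredp_neq0 pI.1; rewrite point_valuation_poly //.
case: x => [q qI|] //=; rewrite eq_sym affine_pointE; case: (boolP (q %| p)) => [qp|].
  have -> : q = p.
    by have /eqP[] : AffinePoint pI == AffinePoint qI by rewrite affine_pointE.
  have := @poly_orderE _ p pI.1 1 1; rewrite mul1r expr1 => -> //.
  by rewrite dvdp1 neq_ltn pI.1.1 orbT.
by move=> /poly_order_ndvd ->.
Qed.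

Lemma affine_idele (p : {poly k}) (pI : monic_irreducible_poly p) :
  exists alpha : idele1 k, is_diagonal p%:F alpha.
Proof.
have p0 : (p%:F : function_field k) != 0 by rewrite tofrac_eq0 (irredp_neq0 pI.1).
pose r := [:: AffinePoint pI; PointAtInfinity k].
have ur : uniq r by rewrite /= inE affine_inf_neq.
have h x : x \notin r -> point_valuation x p%:F = 0.
  rewrite affine_valuation !inE negb_or; case: x => [q qI|] /andP[].
    by move=> /negbTE ->.
  by rewrite eqxx.
have [alpha ha] := diagonal_idele p0 h.
have va x : local_valuation x (alpha x) = point_valuation x p%:F.
  by rewrite ha; exact: diagonal_val.
(* The divisor of [p] is its point, of degree [deg p], minus [deg p] times the point at infinity, of
   degree 1. *)
suff d0 : idele_degree alpha == 0 by exists (Idele1 d0).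
rewrite (@idele_degree_seq r) //; last by move=> x /h; rewrite va.
rewrite !big_cons big_nil addr0 !va !(affine_valuation pI) eqxx.
by rewrite point_degree_affine point_degree_infty mulr1 mul1r subrr.
Qed.

End Global.

(** * Weil reciprocity *)

Lemma symbol_opp (F : fieldType) (a b : F) (m n : nat) :
  a ^ (- n%:Z) / b ^ (- m%:Z) = b ^+ m / a ^+ n.
Proof. by rewrite -!invr_expz invrK mulrC. Qed.

Lemma notin_seq2 (T : eqType) (x a b : T) :
  x \notin [:: a; b] -> x != a /\ x != b.
Proof. by rewrite !inE negb_or => /andP. Qed.

Lemma notin_seq3 (T : eqType) (x a b c : T) :
  x \notin [:: a; b; c] -> [/\ x != a, x != b & x != c].
Proof. by rewrite !inE !negb_or => /and3P. Qed.

Section Weil.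
Variable k : fieldType.
Implicit Types (x : closed_point k) (alpha beta gamma : idele k) (f g : function_field k).

Lemma is_diagonal_val f alpha x : f != 0 -> is_diagonal f alpha ->
  local_valuation x (alpha x) = point_valuation x f.
Proof. by move=> f0 ha; rewrite ha; exact: diagonal_val. Qed.

Lemma value_affine_poly (p : {poly k}) (pI : monic_irreducible_poly p) (a : {poly k}) :
  value_at (AffinePoint pI) a%:F = in_qpoly p a.
Proof.
rewrite -[a%:F]divr1 -tofrac1 value_affineE ?in_qpoly1 ?divr1 //.
by rewrite dvdp1 neq_ltn pI.1.1 orbT.
Qed.

Lemma diagonalX x f n : diagonal x (f ^+ n) = diagonal x f ^+ n.
Proof. by elim: n => [|n IH]; rewrite ?expr0 ?diagonal1 // !exprS diagonalM IH. Qed.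

Lemma diagonalV x f : f != 0 -> diagonal x f^-1 = (diagonal x f)^-1.
Proof. exact: to_completed_fieldV. Qed.

(* The monic polynomials q^m and p^n have the same degree, so their quotient is 1 at
   infinity. *)
Lemma infty_symbol (p q : {poly k}) : p \is monic -> q \is monic ->
  let m := (size p).-1 in let n := (size q).-1 in
  let x := PointAtInfinity k in
  residue (diagonal x p%:F ^ (- n%:Z) / diagonal x q%:F ^ (- m%:Z)) = 1.
Proof.
move=> pm qm m n x.
have pn : p ^+ n \is monic by exact: monic_exp.
have qn : q ^+ m \is monic by exact: monic_exp.
have F0 (a : {poly k}) : a \is monic -> a%:F != 0 :> function_field k.
  by move=> am; rewrite tofrac_eq0 monic_neq0.
have sz : size (p ^+ n) = size (q ^+ m).
  have sX (a : {poly k}) l : a \is monic -> size (a ^+ l) = ((size a).-1 * l).+1.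
    by move=> am; rewrite -size_exp prednK // size_poly_gt0 monic_neq0 // monic_exp.
  by rewrite !sX // mulnC.
have -> : diagonal x p%:F ^ (- n%:Z) / diagonal x q%:F ^ (- m%:Z) =
    diagonal x ((q ^+ m)%:F / (p ^+ n)%:F).
  by rewrite diagonalM diagonalV ?F0 // !tofracXn !diagonalX symbol_opp.
rewrite residue_diagonal.
  rewrite value_inftyE ?monic_neq0 ?sz // -lead_coefE.
  by rewrite (monicP pn) (monicP qn) divr1.
by rewrite frac_val_ge ?monic_neq0 //= sz subrr lexx orbT.
Qed.

Lemma weil_reciprocity (p q : {poly k}) (pI : monic_irreducible_poly p)
    (qI : monic_irreducible_poly q) alpha beta :
  is_diagonal p%:F alpha -> is_diagonal q%:F beta -> idele_pairing alpha beta = 1.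
Proof.
move=> ha hb; set m := (size p).-1; set n := (size q).-1.
have p0 : p%:F != 0 :> function_field k by rewrite tofrac_eq0 (irredp_neq0 pI.1).
have q0 : q%:F != 0 :> function_field k by rewrite tofrac_eq0 (irredp_neq0 qI.1).
have va x : local_valuation x (alpha x) =
    if x is AffinePoint r rI then (x == AffinePoint pI)%:Z else - m%:Z.
  by rewrite (is_diagonal_val x p0 ha) (affine_valuation pI).
have vb x : local_valuation x (beta x) =
    if x is AffinePoint r rI then (x == AffinePoint qI)%:Z else - n%:Z.
  by rewrite (is_diagonal_val x q0 hb) (affine_valuation qI).
pose P := AffinePoint pI; pose Q := AffinePoint qI; pose O := PointAtInfinity k.
have at_infty : local_pairing (alpha O) (beta O) = (-1) ^+ (m * n).
  rewrite /local_pairing va vb point_degree_infty ha hb.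
  rewrite (infty_symbol pI.2 qI.2) field_norm1 mulr1.
  by rewrite mul1r mulrNN.
(* If the points coincide, the symbols are the signs [(-1) ^ m] at P and [(-1) ^ (m * m)] at
   infinity, and [m + m * m] is even. *)
have [PQ|PQ] := eqVneq P Q.
  have pq : p = q by case: PQ.
  have ab x : alpha x = beta x by rewrite ha hb pq.
  rewrite (@idele_pairing_seq _ [:: P; O]); first last.
  - move=> x /notin_seq2[xP xO]; rewrite vb -/Q -PQ.
    by case: x xP xO => [r rI /negbTE ->|] //; rewrite eqxx.
  - move=> x /notin_seq2[xP xO]; rewrite va.
    by case: x xP xO => [r rI /negbTE ->|] //; rewrite eqxx.
  - by rewrite /= inE affine_inf_neq.
  rewrite !big_cons big_nil mulr1 at_infty /local_pairing va vb -/Q -PQ eqxx.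
  rewrite point_degree_affine !mulr1 -ab divff ?expfz_neq0 ?idele_neq0 //.
  rewrite residue1 field_norm1 mulr1 -exprnP -exprD /m /n pq -signr_odd.
  by rewrite oddD oddM andbb addbb.
have QP : (Q == P) = false by rewrite eq_sym; apply/negbTE.
rewrite (@idele_pairing_seq _ [:: P; Q; O]); first last.
- move=> x /notin_seq3[_ xQ xO]; rewrite vb.
  by case: x xQ xO => [r rI /negbTE ->|] //; rewrite eqxx.
- move=> x /notin_seq3[xP _ xO]; rewrite va.
  by case: x xP xO => [r rI /negbTE ->|] //; rewrite eqxx.
- by rewrite /= !in_cons !in_nil !orbF !affine_inf_neq (negbTE PQ).
rewrite !big_cons big_nil mulr1 at_infty.
(* At P only [alpha] has a zero, at Q only [beta]: the symbols are the inverse norm of [q] modulo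
   [p] and the norm of [p] modulo [q]. Their product is the sign of [resultant_sym], which cancels
   the one at infinity. *)
have npq : ~~ (p %| q) by rewrite -(affine_pointE qI pI) -/P -/Q QP.
have vaP : local_valuation P (alpha P) = 1 by rewrite va eqxx.
have vbP : local_valuation P (beta P) = 0 by rewrite vb (negbTE PQ).
have vaQ : local_valuation Q (alpha Q) = 0 by rewrite va QP.
have vbQ : local_valuation Q (beta Q) = 1 by rewrite vb eqxx.
have nq0 : field_norm (in_qpoly p q : residue_field P) != 0.
  by apply: field_norm_neq0; rewrite (in_qpoly_eq0 pI).
have rP : residue (beta P) = in_qpoly p q :> residue_field P.
  by rewrite hb residue_diagonal ?value_affine_poly // -diagonal_ge -hb
    integral_unit_ge0 // idele_integral_unit.
have rQ : residue (alpha Q) = in_qpoly q p :> residue_field Q.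
  by rewrite ha residue_diagonal ?value_affine_poly // -diagonal_ge -ha
    integral_unit_ge0 // idele_integral_unit.
have -> : local_pairing (alpha P) (beta P) =
    (field_norm (in_qpoly p q : residue_field P))^-1.
  rewrite /local_pairing vaP vbP mulr0 expr0z mul1r expr0z mul1r expr1z.
  rewrite residueV; last exact: idele_integral_unit.
  by rewrite (field_normV (residue_unit_neq0 (idele_integral_unit vbP))) rP.
have -> : local_pairing (alpha Q) (beta Q) = field_norm (in_qpoly q p : residue_field Q).
  by rewrite local_pairing_unit ?vbQ ?rQ ?expr1z //; exact: idele_integral_unit.
rewrite (resultant_sym pI qI) -/m -/n mulrA mulrCA mulrC mulrA -mulrA mulVf // mulr1.
by rewrite -exprD -signr_odd oddD addbb.
Qed.

(** * Functions with a prescribed affine divisor *)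

Lemma is_diagonalM f g alpha beta : is_diagonal f alpha -> is_diagonal g beta ->
  is_diagonal (f * g) (alpha * beta)%g.
Proof. by move=> ha hb x; rewrite idele_mulE ha hb diagonalM. Qed.

Lemma is_diagonalV f alpha : f != 0 -> is_diagonal f alpha ->
  is_diagonal f^-1 (alpha^-1)%g.
Proof. by move=> f0 ha x; rewrite idele_invE ha diagonalV. Qed.

(** A property stable under products and inverses, which carries reciprocity from irreducible
    polynomials to the functions built from them. The second argument stays irreducible, so
    multiplicativity in the first one suffices. *)
Definition reciprocal (alpha : idele1 k) : Prop :=
  (exists2 f, f != 0 & is_diagonal f alpha) /\
  forall (q : {poly k}) (qI : monic_irreducible_poly q) (beta : idele k),
    is_diagonal q%:F beta -> idele_pairing alpha beta = 1.

Lemma reciprocal1 : reciprocal 1%g.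
Proof.
split=> [|q qI beta _]; last exact: idele_pairing1.
by exists 1; [exact: oner_neq0 | move=> x; rewrite diagonal1].
Qed.

Lemma reciprocalM (alpha beta : idele1 k) :
  reciprocal alpha -> reciprocal beta -> reciprocal (alpha * beta)%g.
Proof.
move=> [[f f0 hf] ra] [[g g0 hg] rb]; split=> [|q qI gamma hq].
  by exists (f * g); [exact: mulf_neq0 f0 g0 | exact: is_diagonalM hf hg].
have := idele_pairingM alpha beta gamma.
rewrite (ra q qI gamma hq) (rb q qI gamma hq) mulr1 => e; exact: e.
Qed.

Lemma reciprocalV (alpha : idele1 k) : reciprocal alpha -> reciprocal (alpha^-1)%g.
Proof.
move=> [[f f0 hf] ra]; split=> [|q qI gamma hq].
  by exists f^-1; [rewrite invr_eq0 | exact: is_diagonalV f0 hf].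
exact: idele_pairingV (ra q qI gamma hq).
Qed.

Lemma reciprocal_power (p : {poly k}) (pI : monic_irreducible_poly p) (n : int) :
  exists2 alpha : idele1 k, reciprocal alpha &
    forall q (qI : monic_irreducible_poly q), local_valuation (AffinePoint qI)
      (alpha (AffinePoint qI)) = if AffinePoint qI == AffinePoint pI then n else 0.
Proof.
have p0 : p%:F != 0 :> function_field k by rewrite tofrac_eq0 (irredp_neq0 pI.1).
have [pi hpi] := affine_idele pI.
have rpi : reciprocal pi.
  by split=> [|q qI beta hq]; [exists p%:F | exact: weil_reciprocity pI qI _ _ hpi hq].
have vpi q (qI : monic_irreducible_poly q) : local_valuation (AffinePoint qI)
    (pi (AffinePoint qI)) = (AffinePoint qI == AffinePoint pI)%:Z.
  by rewrite (is_diagonal_val _ p0 hpi) (affine_valuation pI).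
elim/int_ind: n => [|n [alpha ra va]|n [alpha ra va]].
- exists 1%g => [|q qI]; first exact: reciprocal1.
  by rewrite if_same; exact: valuation1.
- exists (pi * alpha)%g => [|q qI]; first exact: reciprocalM rpi ra.
  by rewrite [LHS]idele_valM vpi va; case: (_ == _) => //; rewrite intS.
- exists (pi^-1 * alpha)%g => [|q qI]; first exact: reciprocalM (reciprocalV rpi) ra.
  rewrite [LHS]idele_valM [X in X + _]idele_valV vpi va; case: (_ == _) => //.
  by rewrite intS opprD.
Qed.

(** Every divisor on the affine line is principal, k[t] being a principal ideal domain. The
    valuation at infinity is left free: the degree forces it. *)
Lemma reciprocal_divisor (r : seq (closed_point k)) (n : closed_point k -> int) :
  (forall x, x \notin r -> n x = 0) ->
  exists2 alpha : idele1 k, reciprocal alpha &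
    forall q (qI : monic_irreducible_poly q),
      local_valuation (AffinePoint qI) (alpha (AffinePoint qI)) = n (AffinePoint qI).
Proof.
elim: r n => [|y r IH] n hn.
  exists 1%g => [|q qI]; first exact: reciprocal1.
  by rewrite hn //; exact: valuation1.
(* The multiplicity at [y] is set to 0 for the induction hypothesis, then restored by a power of the
   polynomial of [y]; at infinity there is nothing to restore. *)
have [|alpha ra va] := IH (fun x => if x == y then 0 else n x).
  move=> x xr; case: eqVneq => // xy; apply: hn.
  by rewrite in_cons negb_or xy.
case: y hn va => [p pI|] hn va; last first.
  by exists alpha => // q qI; rewrite va affine_inf_neq.
have [beta rb vb] := reciprocal_power pI (n (AffinePoint pI)).
exists (alpha * beta)%g => [|q qI]; first exact: reciprocalM ra rb.
rewrite [LHS]idele_valM va vb; case: eqVneq => [->|_]; by rewrite ?add0r ?addr0.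
Qed.

Lemma point_valuation_const x (c : k) : c != 0 -> point_valuation x (c%:P)%:F = 0.
Proof.
move=> c0; rewrite point_valuation_poly ?polyC_eq0 //; case: x => [p pI|] /=.
  rewrite poly_order_ndvd //; apply/negP => /dvdp_leq.
  by rewrite polyC_eq0 c0 size_polyC c0 => /(_ isT); rewrite leqNgt pI.1.1.
by rewrite size_polyC c0.
Qed.

Lemma value_at_const x (c : k) : value_at x (c%:P)%:F = c%:A.
Proof.
case: x => [p pI|].
  by rewrite value_affine_poly -alg_polyC in_qpolyZ in_qpoly1.
rewrite -[_%:F]divr1 -tofrac1 value_inftyE ?oner_neq0 //.
  by rewrite size_poly1 lead_coef1 divr1 coefC /= /GRing.scale /= mulr1.
by rewrite size_poly1 size_polyC leq_b1.
Qed.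

Lemma const_idele (c : k) : c != 0 ->
  exists alpha : idele1 k, is_diagonal (c%:P)%:F alpha.
Proof.
move=> c0; have C0 : (c%:P)%:F != 0 :> function_field k by rewrite tofrac_eq0 polyC_eq0.
have [alpha ha] := @diagonal_idele k _ [::] C0 (fun x _ => point_valuation_const x c0).
suff d0 : idele_degree alpha == 0 by exists (Idele1 d0).
rewrite (@idele_degree_seq _ [::]) ?big_nil // => x _.
by rewrite (is_diagonal_val _ C0 ha) point_valuation_const.
Qed.

End Weil.

(** * The orthogonal of the principal ideles *)

Lemma divKf2 (F : fieldType) (a b c : F) : a != 0 -> (a / b / c)^-1 * a = b * c.
Proof. by move=> a0; rewrite !invfM !invrK mulrC !mulrA divff // mul1r. Qed.

Lemma dfwith_ind (I : eqType) (T : I -> Type) (f : forall i, T i) (i : I) (a : T i)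
    (P : forall j, T j -> Prop) :
  P i a -> (forall j, P j (f j)) -> forall j, P j (eqtype.dfwith f a j).
Proof. by move=> Pa Pf j; case: eqtype.dfwithP. Qed.

Section Main.
Variable k : fieldType.
Implicit Types (x : closed_point k) (f g : function_field k).

Lemma reduced_class_eq (alpha beta : idele1 k) :
  reduced_class alpha = reduced_class beta <->
  forall x, one_unit (local_valuation x) ((alpha x)^-1 * beta x).
Proof.
have -> : (reduced_class alpha = reduced_class beta) <->
    (alpha^-1 * beta)%g \in @one_unit_idele k.
  by rewrite -(quotient_groupE (@one_unit_normal k)); split=> /eqP.
by split=> [/asboolP|h]; [|apply/asboolP].
Qed.

Lemma class_proj_eq (a b : reduced_idele k) :
  class_proj a = class_proj b <-> principal (a^-1 * b)%g.
Proof.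
rewrite -[principal _]/(_ \in @principal k) -(quotient_groupE (@principal_normal k)).
by split=> /eqP.
Qed.

(** No reciprocity is involved: each local symbol is a power of a norm equal to 1. *)
Lemma prod_norm_one_perp (a : reduced_idele k) :
  prod_norm_one k a -> perp [set b | principal b]%classic a.
Proof.
move=> [alpha -> h] _ /= /asboolP[f f0 [beta _ ->]].
rewrite reduced_pairingE; apply: fsbig1 => x _.
have [ux nx] := h x; rewrite local_pairing_unit; last exact: local_unit_integral.
by rewrite (nx : field_norm _ = 1) exp1rz.
Qed.

(** The degree, which is 0, reduces to the valuation at infinity, a point of degree 1. *)
Lemma idele1_val_infty (alpha : idele1 k) :
  (forall q (qI : monic_irreducible_poly q),
    local_valuation (AffinePoint qI) (alpha (AffinePoint qI)) = 0) ->
  local_valuation (PointAtInfinity k) (alpha (PointAtInfinity k)) = 0.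
Proof.
move=> h; have /eqP := valP alpha.
rewrite (@idele_degree_seq _ [:: PointAtInfinity k]) //.
  by rewrite big_cons big_nil addr0 point_degree_infty mul1r.
by case=> [q qI _|]; [exact: h | rewrite mem_seq1 eqxx].
Qed.

Lemma perp_prod_norm_one (a : reduced_idele k) :
  perp [set b | principal b]%classic a ->
  exists2 b, prod_norm_one k b & class_proj b = class_proj a.
Proof.
move=> ha; pose alpha : idele1 k := repr a.
have ea : a = reduced_class alpha by rewrite /reduced_class reprK.
pose O := PointAtInfinity k.
have test (gamma : idele1 k) f : f != 0 -> is_diagonal f gamma ->
    idele_pairing alpha gamma = 1.
  move=> f0 hf; rewrite -reduced_pairingE -ea; apply: ha => /=.
  by apply/asboolP; exists f => //; exists gamma.
have [r hr] := idele_val_seq alpha.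
have [phi [[f f0 hf] rphi] vphi] :=
  @reciprocal_divisor k r (fun x => local_valuation x (alpha x)) hr.
pose u : idele1 k := (alpha * phi^-1)%g.
have vu q (qI : monic_irreducible_poly q) :
    local_valuation (AffinePoint qI) (u (AffinePoint qI)) = 0.
  rewrite [LHS]idele_valM [X in _ + X]idele_valV vphi; exact: subrr.
have uu x : integral_unit (u x).
  apply: idele_integral_unit; case: x => [q qI|]; [exact: vu|].
  exact: idele1_val_infty vu.
pose c : k := residue (u O).
have c0 : c != 0 by exact: residue_unit_neq0.
(* Only the point Q of [q] and infinity contribute to the pairing with [q], whose valuations there
   are 1 and [- deg q]: it reads [N(u_Q) * c ^ (- deg q) = 1]. *)
have Nu q (qI : monic_irreducible_poly q) :
    field_norm (residue (u (AffinePoint qI))) = c ^+ (size q).-1.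
  have q0 : q%:F != 0 :> function_field k by rewrite tofrac_eq0 (irredp_neq0 qI.1).
  have [gamma hg] := affine_idele qI.
  have vg x : local_valuation x (gamma x) =
      if x is AffinePoint r rI then (x == AffinePoint qI)%:Z else - (size q).-1%:Z.
    by rewrite (is_diagonal_val x q0 hg) (affine_valuation qI).
  have : idele_pairing u gamma = 1.
    have := idele_pairingM alpha (phi^-1)%g gamma.
    rewrite (test gamma _ q0 hg) (idele_pairingV (rphi q qI gamma hg)) mulr1 => e.
    exact: e.
  rewrite (@idele_pairing_seq _ [:: AffinePoint qI; O]); first last.
  - move=> x /notin_seq2[xQ xO]; rewrite vg.
    by case: x xQ xO => [s sI /negbTE ->|] //; rewrite eqxx.
  - move=> x _; have /andP[_ /eqP] := uu x; exact.
  - by rewrite /= mem_seq1 affine_inf_neq.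
  rewrite !big_cons big_nil mulr1 !local_pairing_unit // !vg eqxx expr1z.
  rewrite field_norm_infty -/c -invr_expz => /(canRL (mulfVK _)) ->; last first.
    by rewrite expf_neq0.
  by rewrite mul1r.
have [kappa hk] := const_idele c0.
have C0 : (c%:P)%:F != 0 :> function_field k by rewrite tofrac_eq0 polyC_eq0.
have uk x : integral_unit (kappa x).
  by apply: idele_integral_unit; rewrite (is_diagonal_val _ C0 hk) point_valuation_const.
have rk x : residue (kappa x) = c%:A.
  rewrite hk residue_diagonal ?value_at_const //.
  by rewrite val_geE // point_valuation_const.
(* Dividing also by the constant [c] makes every norm 1, as [N(c) = c ^ deg x]; in all, [alpha] has
   been divided by the principal idele of [f * c]. *)
exists (reduced_class (u * kappa^-1)%g); last first.
  apply/class_proj_eq/asboolP; exists (f * (c%:P)%:F); first exact: mulf_neq0 f0 C0.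
  exists (phi * kappa)%g; first exact: is_diagonalM hf hk.
  rewrite ea -reduced_classV -reduced_classM; congr reduced_class.
  apply: val_inj; apply: idele_inj => x.
  change ((alpha x * (phi x)^-1 * (kappa x)^-1)^-1 * alpha x = phi x * kappa x).
  exact: divKf2 (idele_neq0 alpha x).
exists (u * kappa^-1)%g => // x.
have ukV := integral_unitV (uk x).
have -> : (u * kappa^-1)%g x = u x * (kappa x)^-1 by [].
have e : residue (u x * (kappa x)^-1) = residue (u x) / c%:A.
  rewrite (residueM (integral_unit_ge0 (uu x)) (integral_unit_ge0 ukV)).
  by rewrite (residueV (uk x)) rk.
split; first exact: integral_unitP (integral_unitM (uu x) ukV).
rewrite /norm_one /= e field_normM field_normV; last first.
  by rewrite scaler_eq0 (negbTE c0) oner_eq0.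
rewrite field_norm_scalar -/(point_degree x).
case: x {ukV e} => [q qI|].
  by rewrite Nu point_degree_affine divff // expf_neq0.
by rewrite field_norm_infty -/c point_degree_infty expr1 divff.
Qed.

(** In lowest terms, an irreducible factor of the denominator would give a pole, so the denominator
    is constant; the valuation at infinity then makes the numerator constant. *)
Lemma unit_function_const f : f != 0 -> (forall x, point_valuation x f = 0) ->
  exists c : k, f = (c%:P)%:F.
Proof.
move=> f0 vf.
have [a [b [b0 cop ef]]] : exists a b : {poly k},
    [/\ b != 0, coprimep a b & f = a%:F / b%:F].
  move: (frac_numden f) (denom_ratioP (repr f)).
  move: (\n_(repr f)) (\d_(repr f)) => a b -> b0.
  have g0 : gcdp a b != 0 by rewrite gcdp_eq0 negb_and b0 orbT.
  have bg0 : b %/ gcdp a b != 0 by rewrite divpN0 ?dvdp_leq ?dvdp_gcdr.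
  exists (a %/ gcdp a b), (b %/ gcdp a b); split=> //.
    by apply: coprimep_div_gcd; rewrite b0 orbT.
  apply/eqP; rewrite eqr_div ?tofrac_eq0 // -!tofracM tofrac_eq.
  by rewrite -divp_mulCA ?dvdp_gcdl ?dvdp_gcdr // mulrC.
have a0 : a != 0 by apply: contraNneq f0 => a0; rewrite ef a0 tofrac0 mul0r.
have {}vf x : poly_valuation x a = poly_valuation x b.
  have := vf x; rewrite ef [LHS]frac_vfunE //; exact: subr0_eq.
have sb : (size b <= 1)%N.
  rewrite leqNgt; apply/negP => /irreducible_factor[p pI pb].
  have pa : ~~ (p %| a).
    rewrite -(irreducible_poly_coprime _ pI.1) coprimep_sym.
    exact: coprimep_dvdl pb cop.
  have := vf (AffinePoint pI); rewrite /= (poly_order_ndvd pI pa) => -[e].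
  by have := poly_order_ge1 pI b0; rewrite pb -e.
have sa : (size a <= 1)%N.
  have := vf (PointAtInfinity k); move: a0 b0 sb; rewrite -!size_poly_gt0 /=.
  move: (size a) (size b) => m n; lia.
exists (a`_0 / b`_0); rewrite ef (size1_polyC sa) (size1_polyC sb) !coefC /=.
have b00 : b`_0 != 0 by apply: contraNneq b0 => e; rewrite (size1_polyC sb) e.
apply: (canLR (mulfK _)); first by rewrite tofrac_eq0 polyC_eq0.
by rewrite -tofracM -polyCM divfK.
Qed.

Lemma prod_norm_one_inj : set_inj (prod_norm_one k) (@class_proj k).
Proof.
move=> a b /set_mem[alpha ea ha] /set_mem[beta eb hb] /class_proj_eq/asboolP.
move=> [f f0 [gamma hg]]; rewrite ea eb -reduced_classV -reduced_classM.
move=> /reduced_class_eq hu.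
have ua x := local_unit_integral (ha x).1; have ub x := local_unit_integral (hb x).1.
pose u x := ((alpha^-1 * beta)%g x)^-1 * gamma x.
have {}hu x : one_unit (local_valuation x) (u x) by exact: hu.
have uab x := integral_unitM (integral_unitV (ua x)) (ub x).
have eg x : gamma x = ((alpha x)^-1 * beta x) * u x.
  by rewrite /u (mulVKf (_ : (alpha^-1 * beta)%g x != 0)) //; case/andP: (uab x).
have vg x : local_valuation x (gamma x) = 0.
  rewrite eg one_unit_valM //; first by case/andP: (uab x) => _ /eqP.
  by case/andP: (uab x).
have [c ec] : exists c : k, f = (c%:P)%:F.
  by apply: unit_function_const => // x; rewrite -(is_diagonal_val x f0 hg).
(* At infinity the norm is the identity, so [alpha] and [beta] both have residue 1 there, and hence
   so has the constant. *)
have c1 : c = 1.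
  pose O := PointAtInfinity k.
  have rg : residue (gamma O) = c.
    rewrite hg ec residue_diagonal ?value_at_const; first by rewrite /GRing.scale /= mulr1.
    by rewrite val_geE -?ec // -(is_diagonal_val O f0 hg) vg.
  have := residue_one_unit (integral_unit_ge0 (uab O)) (hu O); rewrite -eg rg => ->.
  have r1 (d : residue_field O) : norm_one O d -> d = 1.
    by rewrite /norm_one /= field_norm_infty.
  rewrite (residueM (integral_unit_ge0 (integral_unitV (ua O))) (integral_unit_ge0 (ub O))).
  by rewrite (residueV (ua O)) (r1 _ (ha O).2) (r1 _ (hb O).2) invr1 mulr1.
apply/reduced_class_eq => x; rewrite -[_ * _](mulfK (one_unit_val (hu x)).1) -eg.
rewrite hg ec c1 diagonal1 mul1r; exact: one_unitV.
Qed.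

(** The idele is [f] at [x] and 1 elsewhere; it realises a single factor of the product of norm-one
    groups. *)
Lemma norm_one_idele x f : val_ge (point_valuation x) 0 f ->
  field_norm (value_at x f) = 1 ->
  exists2 alpha : idele1 k, prod_norm_one k (reduced_class alpha) &
    integral_unit (alpha x) /\ residue (alpha x) = value_at x f.
Proof.
move=> f0 nf; 
pose al := @eqtype.dfwith _ (fun y => local_field y) (fun=> 1) x (diagonal x f).
have c0 : value_at x f != 0.
  apply: contra_eq_neq nf => ->; rewrite -(scale0r 1) field_norm_scalar.
  by rewrite expr0n eqn0Ngt adim_gt0 eq_sym oner_eq0.
have F0 : f != 0.
  apply: contraNneq c0 => ->; rewrite value_at_eq0 ?val_ge0 //.
have u1 (y : closed_point k) : integral_unit (1 : local_field y).
  by apply/andP; split; [exact: oner_neq0 | apply/eqP; exact: valuation1].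
have ux : integral_unit (diagonal x f).
  apply/andP; split; first exact: diagonal_neq0.
  rewrite diagonal_val //; move: c0 (f0); rewrite (value_at_eq0 f0) !val_geE //.
  by move: (point_valuation x f) => m; lia.
have uy y : integral_unit (al y).
  exact: (dfwith_ind (P := fun z b => is_true (@integral_unit k z b)) ux u1).
have int (h : forall y : closed_point k, local_field y) :
    (forall y, integral_unit (h y)) -> adele h.
  move=> uh; apply: sub_finite_set (finite_set0 _) => y /=; apply.
  exact: completed_field_integer (integral_unit_ge0 (uh y)).
have unit : exists2 b, adele b & forall y, al y * b y = 1.
  exists (fun y => (al y)^-1); first by apply: int => y; exact: integral_unitV.
  by move=> y; rewrite divff //; case/andP: (uy y).
pose alpha := Idele (int al uy) unit.
have d0 : idele_degree alpha == 0.
  rewrite (@idele_degree_seq _ [::]) ?big_nil // => y _.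
  by case/andP: (uy y) => _ /eqP.
have rx : residue (al x) = value_at x f by rewrite /al eqtype.dfwith_in residue_diagonal.
exists (Idele1 d0); last by split; [exact: uy | exact: rx].
exists (Idele1 d0) => // y; split; first exact: integral_unitP (uy y).
change (field_norm (residue (al y)) = 1).
apply: (dfwith_ind (P := fun z b => field_norm (@residue k z b) = 1)) => [|z].
  by rewrite residue_diagonal.
by rewrite residue1 field_norm1.
Qed.

(** * Triviality of the norm-one groups and algebraic closedness *)

Lemma prod_norm_one1 : prod_norm_one k 1%g.
Proof.
exists 1%g => // x; split; last by rewrite /norm_one /= residue1 field_norm1.
by apply: integral_unitP; apply: idele_integral_unit; exact: valuation1.
Qed.

Lemma closed_field_irreducible : GRing.closed_field_axiom k <->
  forall p : {poly k}, monic_irreducible_poly p -> size p = 2.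
Proof.
split=> [closed p [[p1 pI] pm]|deg1 n P n0].
  have n0 : (0 < (size p).-1)%N by rewrite -ltnS (ltn_predK p1).
  (* The axiom solves [X ^ n = \sum_i P i * X ^ i]; with [P i = - p_i] the solution is a root of the
     monic polynomial [p]. *)
  have [c hc] := closed _ (fun i => - p`_i) n0.
  have pc : root p c.
    rewrite rootE horner_coef -(prednK (ltnW p1)) big_ord_recr /=.
    rewrite -lead_coefE (monicP pm) mul1r hc -big_split big1 //= => i _.
    by rewrite mulNr subrr.
  have : 'X - c%:P %= p by apply: pI; rewrite ?size_XsubC // dvdp_XsubCl.
  by move=> /eqp_size <-; rewrite size_XsubC.
pose q := 'X^n - \poly_(i < n) P i.
have sq : size q = n.+1.
  by rewrite size_polyDl size_polyXn // size_polyN ltnS size_poly.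
have [|p pI pq] := @irreducible_factor k q; first by rewrite sq.
have [c pc] := poly2_root (deg1 p pI); exists c.
have /eqP := root_dvdp pq pc; rewrite hornerD hornerN hornerXn horner_poly.
by move=> /subr0_eq.
Qed.

Lemma prod_norm_one_trivial (k_infinite : infinite_set [set: k])
    (k_perfect : perfect_field k) :
  (prod_norm_one k `<=` [set 1%g])%classic <-> GRing.closed_field_axiom k.
Proof.
rewrite closed_field_irreducible; split=> [N1 p pI|deg1 a [alpha -> ha]].
  apply: (trivial_norm_one_size (pI := pI) k_infinite (k_perfect p pI.1)) => c nc.
  pose x := AffinePoint pI.
  (* An element of the residue field is stored as a polynomial of degree less than [deg p], its own
     remainder; so it is the value of that polynomial. *)
  have vc : value_at x (c : {poly k})%:F = c.
    rewrite value_affine_poly; apply: val_inj.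
    exact: in_qpoly_small (size_mk_monic c).
  have f0 : val_ge (point_valuation x) 0 (c : {poly k})%:F.
    have [->|c0] := eqVneq (c : {poly k}) 0; first by rewrite tofrac0 val_ge0.
    by rewrite val_geE ?tofrac_eq0 // point_valuation_poly.
  have [|alpha pa [ua]] := norm_one_idele f0; first by rewrite vc.
  rewrite vc => <-.
  have /(@esym _ _ _)/reduced_class_eq/(_ x) : reduced_class alpha = reduced_class 1%g.
    exact: N1.
  by rewrite invr1 mul1r -(residue_eq1 (integral_unit_ge0 ua)) => /eqP.
(* When all points have degree 1, norm 1 forces residue 1, which means a one-unit at each point. *)
apply/esym/reduced_class_eq => x; rewrite invr1 mul1r.
have [/local_unit_integral ux nx] := ha x.
rewrite -residue_eq1 ?integral_unit_ge0 //; apply/eqP; apply: (field_norm_dim1 _ nx).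
rewrite -/(point_degree x); case: x {ux nx} => [p pI|]; last exact: point_degree_infty.
by rewrite point_degree_affine deg1.
Qed.

End Main.

Local Open Scope classical_set_scope.
Local Open Scope ring_scope.

(** The first clause makes [prod_norm_one] a subgroup of the quotient; it also allows triviality in
    the last clause to be tested on [prod_norm_one] itself. *)
Theorem corollary4p10 (k : fieldType)
    (k_infinite : infinite_set [set: k]) (k_perfect : perfect_field k) :
  let Sigma_star : set (reduced_idele k) := [set a | principal a] in
  let perp_mod_Sigma_star : set (reduced_idele_class k) :=
    [set class_proj a | a in perp Sigma_star] in
  [/\ set_inj (prod_norm_one k) (@class_proj k),
      [set class_proj a | a in prod_norm_one k] = perp_mod_Sigma_star
    & perp_mod_Sigma_star = [set 1%g] <-> GRing.closed_field_axiom k].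
Proof.
move=> S M.
have inj := @prod_norm_one_inj k.
have eM : [set class_proj a | a in prod_norm_one k]%classic = M.
  apply/seteqP; split=> [_ [a ha <-]|_ [a /perp_prod_norm_one[b hb <-] <-]].
    by exists a => //; exact: prod_norm_one_perp.
  by exists b.
split=> //; rewrite -eM -(prod_norm_one_trivial k_infinite k_perfect).
have N1 := prod_norm_one1 k.
split=> [e a ha|e].
  apply: inj; [exact: mem_set ha | exact: mem_set N1 |].
  have : [set class_proj a | a in prod_norm_one k]%classic (class_proj a) by exists a.
  by rewrite e => ->.
apply/seteqP; split=> [_ [a /e -> <-] //|_ ->]; by exists 1%g.
Qed.
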